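(* Let $p\ge0$ and $S=\{\lambda_n,\alpha_n\}_{n\ge1}\in\mathcal S_p$. Define $A(S)=\#\{n\ge1:\alpha_n=0\}$; $\mathcal I(S)=\{n\ge1:(n=1\text{ or }\lambda_n\neq\lambda_k\text{ for all }k<n)\text{ and }\alpha_n\neq0\}$; for $k\in\mathcal I(S)$, $m_k=\#\{n\ge1:\lambda_n=\lambda_k\text{ and }\alpha_n\neq0\}$; and $B(S)=\sum_{k\in\mathcal I(S)}(m_k-1)$ (a finite sum). If $A(S)+B(S)\ge p+1$, then the operator $E+\tilde H(\pi)$ is not invertible on $m$.
   Context: $\mathcal S_p$: collections $S=\{\lambda_n,\alpha_n\}_{n\ge1}$ of complex numbers with $\rho_n:=\sqrt{\lambda_n}$ ($\arg\rho_n\in[-\pi/2,\pi/2)$), $\rho_n=n-p-1+\varkappa_n$, $\alpha_n=2/\pi+\kappa_n$, $\{\varkappa_n\},\{\kappa_n\}\in l_2$. Model data: $\tilde\rho_n=0$ for $n\le p+1$, $\tilde\rho_n=n-p-1$ for $n\ge p+1$, $\tilde\lambda_n=\tilde\rho_n^2$; $\tilde\alpha_1=1/\pi$, $\tilde\alpha_n=0$ for $2\le n\le p+1$, $\tilde\alpha_n=2/\pi$ for $n\ge p+2$. Operator $\tilde H(x)$ built from $S$: $\lambda_{n0}=\lambda_n,\rho_{n0}=\rho_n,\alpha_{n0}=\alpha_n$, $\lambda_{n1}=\tilde\lambda_n,\rho_{n1}=\tilde\rho_n,\alpha_{n1}=\tilde\alpha_n$, $\hat\rho_n=\rho_n-\tilde\rho_n$;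 $\tilde D(x,\lambda,\mu)=\int_0^x\cos(\sqrt\lambda t)\cos(\sqrt\mu t)dt$; $\tilde Q_{ni,kj}(x)=\alpha_{kj}\tilde D(x,\rho_{ni}^2,\rho_{kj}^2)$; $\tilde Q_{nk}=\begin{pmatrix}\tilde Q_{n0,k0}&-\tilde Q_{n0,k1}\\ \tilde Q_{n1,k0}&-\tilde Q_{n1,k1}\end{pmatrix}$; $T_k^{-1}=\begin{pmatrix}\hat\rho_k&1\\0&1\end{pmatrix}$; for $\hat\rho_n\neq0$, $T_n=\begin{pmatrix}\hat\rho_n^{-1}&-\hat\rho_n^{-1}\\0&1\end{pmatrix}$ and $\tilde H_{nk}=T_n\tilde Q_{nk}T_k^{-1}$; for $\hat\rho_n=0$, $\tilde H_{nk}=\begin{pmatrix}\partial_\rho[\alpha_{k0}\tilde D(x,\rho^2,\lambda_{k0})]_{\rho=\rho_{n0}}&-\partial_\rho[\alpha_{k1}\tilde D(x,\rho^2,\lambda_{k1})]_{\rho=\rho_{n0}}\\ \tilde Q_{n1,k0}&-\tilde Q_{n1,k1}\end{pmatrix}T_k^{-1}$. $m$: Banach space of bounded sequences $(a_{ni})_{n\ge1,i=0,1}$ with sup norm; $(\tilde H(x)a)_n=\sum_k\tilde H_{nk}(x)a_k$, $a_k=(a_{k0},a_{k1})^T$; $E$ identity. *)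

(* Defs.v *)
From Stdlib Require Import Reals ClassicalEpsilon ClassicalDescription.
From Coquelicot Require Import Coquelicot.
Open Scope R_scope.

Definition CR (r : R) : C := RtoC r.

Definition Ccos (z : C) : C :=
  (cos (fst z) * cosh (snd z), - (sin (fst z) * sinh (snd z))).

(* The branch of the square root used in the paper:
   rho = sqrt(lambda) with arg rho in [-pi/2, pi/2), i.e.
   Re rho > 0, or Re rho = 0 and Im rho <= 0. *)
Definition sqrt_branch (lam r : C) : Prop :=
  (r * r = lam)%C /\ (0 < fst r \/ (fst r = 0 /\ snd r <= 0)).

(* the square root sqrt(lambda) with that branch (it exists and is unique) *)
Definition Csqrt (lam : C) : C :=
  epsilon (inhabits (RtoC 0)) (fun r => sqrt_branch lam r).

Definition CRInt (f : R -> C) (x : R) : C :=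
  (RInt (fun t => fst (f t)) 0 x, RInt (fun t => snd (f t)) 0 x).

Definition Cderiv (f : C -> C) (z : C) : C :=
  epsilon (inhabits (RtoC 0))
    (fun d => @is_derive C_AbsRing C_NormedModule f z d).

Definition Dt (x : R) (lam mu : C) : C :=
  CRInt (fun t => (Ccos (Csqrt lam * CR t) * Ccos (Csqrt mu * CR t))%C) x.

(* ---------- the class S_p ----------
   INDEXING: the paper indexes by n >= 1; here a sequence u : nat -> C
   stores the paper's u_n at position n-1, i.e. u j = u_{j+1}. *)

Definition l2 (u : nat -> C) : Prop := ex_series (fun j => Cmod (u j) ^ 2).

Definition rho_of (lam : nat -> C) (j : nat) : C := Csqrt (lam j).

(* S = {lambda_n, alpha_n} in S_p :
   rho_n = n - p - 1 + varkappa_n, alpha_n = 2/pi + kappa_n, both in l2.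
   With j = n-1: n - p - 1 = j - p. *)
Definition in_Sp (p : nat) (lam alpha : nat -> C) : Prop :=
  exists varkappa kappa : nat -> C,
    l2 varkappa /\ l2 kappa /\
    (forall j, rho_of lam j = (CR (INR j - INR p) + varkappa j)%C) /\
    (forall j, alpha j = (CR (2 / PI) + kappa j)%C).

Definition rho_model (p j : nat) : C :=
  if Nat.leb j p then CR 0 else CR (INR j - INR p).
Definition lam_model (p j : nat) : C := (rho_model p j * rho_model p j)%C.
Definition alpha_model (p j : nat) : C :=
  if Nat.eqb j 0 then CR (1 / PI)
  else if Nat.leb j p then CR 0 else CR (2 / PI).

Record M2 := mkM2 { m11 : C; m12 : C; m21 : C; m22 : C }.
Definition M2mul (A B : M2) : M2 :=
  mkM2 (m11 A * m11 B + m12 A * m21 B)%C (m11 A * m12 B + m12 A * m22 B)%C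
       (m21 A * m11 B + m22 A * m21 B)%C (m21 A * m12 B + m22 A * m22 B)%C.
Definition M2app (A : M2) (v : C * C) : C * C :=
  ((m11 A * fst v + m12 A * snd v)%C, (m21 A * fst v + m22 A * snd v)%C).

Section H.
Variables (p : nat) (lam alpha : nat -> C).

(* lambda_{n i}, rho_{n i}, alpha_{n i}, i = 0 (false) / 1 (true) *)
Definition lamI (j : nat) (i : bool) : C := if i then lam_model p j else lam j.
Definition rhoI (j : nat) (i : bool) : C := if i then rho_model p j else rho_of lam j.
Definition alphaI (j : nat) (i : bool) : C := if i then alpha_model p j else alpha j.

Definition rho_hat (j : nat) : C := (rho_of lam j - rho_model p j)%C.

Definition Qe (x : R) (n : nat) (i : bool) (k : nat) (jj : bool) : C :=
  (alphaI k jj * Dt x (rhoI n i * rhoI n i) (rhoI k jj * rhoI k jj))%C.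

Definition Qmat (x : R) (n k : nat) : M2 :=
  mkM2 (Qe x n false k false) (- Qe x n false k true)%C
       (Qe x n true k false) (- Qe x n true k true)%C.

Definition Tinv (k : nat) : M2 := mkM2 (rho_hat k) (CR 1) (CR 0) (CR 1).
Definition Tm (n : nat) : M2 :=
  mkM2 (/ rho_hat n)%C (- / rho_hat n)%C (CR 0) (CR 1).

Definition dQe (x : R) (n : nat) (k : nat) (jj : bool) : C :=
  Cderiv (fun r => (alphaI k jj * Dt x (r * r) (lamI k jj))%C) (rho_of lam n).

Definition Hmat (x : R) (n k : nat) : M2 :=
  if excluded_middle_informative (rho_hat n = CR 0) then
    M2mul (mkM2 (dQe x n k false) (- dQe x n k true)%C
                (Qe x n true k false) (- Qe x n true k true)%C) (Tinv k)
  else M2mul (M2mul (Tm n) (Qmat x n k)) (Tinv k).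
End H.

(* element of m: a : nat -> C * C, a j = (a_{n0}, a_{n1}) with n = j+1 *)
Definition bounded_seq (a : nat -> C * C) : Prop :=
  exists M : R, forall j, Cmod (fst (a j)) <= M /\ Cmod (snd (a j)) <= M.

(* (E + H) a = b, where (H a)_n = sum_k H_{nk} a_k (series converging in C) *)
Definition EH_maps (H : nat -> nat -> M2) (a b : nat -> C * C) : Prop :=
  forall n,
    @is_series C_AbsRing C_NormedModule
      (fun k => fst (M2app (H n k) (a k))) (fst (b n) - fst (a n))%C /\
    @is_series C_AbsRing C_NormedModule
      (fun k => snd (M2app (H n k) (a k))) (snd (b n) - snd (a n))%C.

Definition invertible_on_m (H : nat -> nat -> M2) : Prop :=
  forall b, bounded_seq b ->
    exists a, bounded_seq a /\ EH_maps H a b /\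
      forall a', bounded_seq a' -> EH_maps H a' b -> a' = a.

Fixpoint count_lt (P : nat -> Prop) (N : nat) : nat :=
  match N with
  | O => O
  | S N' => (count_lt P N' + if excluded_middle_informative (P N') then 1 else 0)%nat
  end.

Fixpoint sum_lt (P : nat -> Prop) (f : nat -> nat) (N : nat) : nat :=
  match N with
  | O => O
  | S N' => (sum_lt P f N' + if excluded_middle_informative (P N') then f N' else 0)%nat
  end.

Definition in_I (lam alpha : nat -> C) (k : nat) : Prop :=
  (forall j, (j < k)%nat -> lam j <> lam k) /\ alpha k <> CR 0.

(* truncations to indices j < N of A(S) and B(S); they are nondecreasing in N
   and (S in S_p) eventually equal to A(S), B(S) *)
Definition A_trunc (alpha : nat -> C) (N : nat) : nat :=
  count_lt (fun j => alpha j = CR 0) N.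
Definition m_trunc (lam alpha : nat -> C) (k N : nat) : nat :=
  count_lt (fun j => lam j = lam k /\ alpha j <> CR 0) N.
Definition B_trunc (lam alpha : nat -> C) (N : nat) : nat :=
  sum_lt (in_I lam alpha) (fun k => m_trunc lam alpha k N - 1)%nat N.

Definition AB_ge (lam alpha : nat -> C) (q : nat) : Prop :=
  exists N, (q <= A_trunc alpha N + B_trunc lam alpha N)%nat.

(* Main.v *)
Require Import Defs.
From Stdlib Require Import Reals Lra Lia List Arith ClassicalEpsilon ClassicalDescription.
From Coquelicot Require Import Coquelicot.

(* The kernel of [E + H(PI)] is shown to be nontrivial.  For an absolutely
   summable [g] put [G(r) = sum_i g_i K(r, i)], where [K(r, i)] is the integral of
   [cos (r t) cos (i t)] over [[0, PI]].  If [G(rho_n) = 0] whenever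
   [alpha_n <> 0], then [a_n1 = G(rho~_n)] and [a_n0 =] the difference quotient of
   [G] between [rho_n] and [rho~_n] (its derivative if they coincide) form a
   bounded sequence killed by [E + H(PI)]: the [alpha_n] terms drop out and the
   model terms reproduce the expansion of [G] by orthogonality of the [cos (i t)].
   It is nonzero because [G(i)] is a nonzero multiple of [g_i].

   To find [g <> 0]: since [rho_(m+p) = m + l2], the matrix
   [K(rho_(m+p), i) - K(m, i)] restricted to rows [m >= M] has small column sums,
   so the equations [G(rho_(m+p)) = 0], [m >= M], are solved in l1 by a Neumann
   series with [g_0, ..., g_(M-1)] prescribed freely.  The hypothesis
   [A + B >= p + 1] leaves at most [M - 1] distinct equations among the first
   [M + p] indices, fewer than the [M] free parameters. *)

(** The matrix [T_k^(-1)] sends [(a_k0, a_k1)] to [(rho^_k a_k0 + a_k1, a_k1)], where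
    [rho^_k = rho_k - rho~_k]. With [a_k1 = G(rho~_k)] and [a_k0] a difference quotient, this is
    [(G(rho_k), G(rho~_k))]; hence the quotient, which must stay bounded as the two points merge.
    [G] is the cosine transform over [[0, PI]] of [sum_i g_i cos (i t)], so the claim is that the
    [cos (rho_n t)] with [alpha_n <> 0] are incomplete. The shift [n - p - 1] supplies [p]
    frequencies more than the system [cos (m t)], [m >= 0]; zero weights and repeated values take
    away at least [p + 1], leaving a deficit of one. The perturbation [K(m + kap_m, i) - K(m, i)] is
    of order [|kap_m| / (1 + |m - i|)] with [kap] only in l2. Row sums of this bound diverge,
    whereas column sums are controlled by Cauchy-Schwarz uniformly in [i]; small column sums mean
    exactly a contraction of l1, which dictates the space. Moreover an l1 sequence can be summed
    against any bounded kernel. *)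

(** * Absolutely summable sequences and contractions in l1 *)

(* [sum_n] leaves goals typed in the carrier of an abelian monoid; [ring] and
   [field] need the concrete type. *)
Ltac in_R := change (@plus R_AbelianMonoid) with Rplus;
  match goal with |- @eq _ ?x ?y => change (@eq R x y) end.
Ltac in_C := change (@plus C_AbelianMonoid) with Cplus;
  match goal with |- @eq _ ?x ?y => change (@eq C x y) end.

Lemma sum_n_le_loc (u v : nat -> R) (N : nat) :
  (forall i, (i <= N)%nat -> u i <= v i) -> sum_n u N <= sum_n v N.
Proof.
  induction N as [|N IH]; intros H.
  - rewrite !sum_O; auto.
  - rewrite !sum_Sn. apply Rplus_le_compat; [apply IH; intros; apply H; lia | apply H; lia].
Qed.

Lemma sum_n_nonneg (u : nat -> R) (N : nat) : (forall i, 0 <= u i) -> 0 <= sum_n u N.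
Proof.
  intros H; induction N as [|N IH].
  - rewrite sum_O; auto.
  - rewrite sum_Sn; apply Rplus_le_le_0_compat; auto.
Qed.

Lemma sum_n_scal_R (c : R) (u : nat -> R) (N : nat) :
  sum_n (fun i => c * u i) N = c * sum_n u N.
Proof. exact (sum_n_mult_l (K := R_Ring) c u N). Qed.

Lemma sum_n_plus_R (u v : nat -> R) (N : nat) :
  sum_n (fun i => u i + v i) N = sum_n u N + sum_n v N.
Proof. exact (sum_n_plus (G := R_AbelianMonoid) u v N). Qed.

Lemma term_le_sum_n (u : nat -> R) (N i : nat) :
  (forall j, 0 <= u j) -> (i <= N)%nat -> u i <= sum_n u N.
Proof.
  intros Hu; induction N as [|N IH]; intros Hi.
  - replace i with 0%nat by lia. rewrite sum_O; lra.
  - rewrite sum_Sn. change plus with Rplus.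
    assert (H0 := sum_n_nonneg u N Hu). assert (H1 := Hu (S N)).
    destruct (Nat.eq_dec i (S N)) as [->|Hne]; [lra|].
    assert (u i <= sum_n u N) by (apply IH; lia). lra.
Qed.

Lemma Cmod_sum_n_le (u : nat -> C) (N : nat) :
  Cmod (sum_n u N) <= sum_n (fun i => Cmod (u i)) N.
Proof.
  induction N as [|N IH].
  - rewrite !sum_O; lra.
  - rewrite !sum_Sn. eapply Rle_trans; [apply Cmod_triangle|].
    apply Rplus_le_compat_r, IH.
Qed.

(** A bound on all partial sums rather than a value of the norm: estimates then carry no convergence
    proofs, and summability is recovered from them in [l1_le_ex_series]. *)
Definition l1_le (u : nat -> C) (M : R) : Prop :=
  forall N, sum_n (fun i => Cmod (u i)) N <= M.

Notation Cseries := (@is_series C_AbsRing C_NormedModule) (only parsing).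

Lemma l1_le_term (u : nat -> C) (M : R) (i : nat) : l1_le u M -> Cmod (u i) <= M.
Proof.
  intros H. eapply Rle_trans; [|apply (H i)].
  apply (term_le_sum_n (fun i => Cmod (u i))); auto using Cmod_ge_0.
Qed.

Lemma l1_le_pos (u : nat -> C) (M : R) : l1_le u M -> 0 <= M.
Proof. intros H; eapply Rle_trans; [apply Cmod_ge_0 | exact (l1_le_term u M 0 H)]. Qed.

Lemma l1_le_ex_series (u : nat -> C) (M : R) : l1_le u M -> exists l, Cseries u l.
Proof.
  intros H.
  apply (ex_series_le (V := C_CompleteNormedModule) u (fun i => Cmod (u i))).
  - intros n; apply Rle_refl.
  - destruct (ex_finite_lim_seq_incr (sum_n (fun i => Cmod (u i))) M) as [l Hl].
    + intros n; rewrite sum_Sn. change plus with Rplus.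
      assert (H0 := Cmod_ge_0 (u (S n))); lra.
    + exact H.
    + exists l; exact Hl.
Qed.

Definition Csum (u : nat -> C) : C :=
  epsilon (inhabits (RtoC 0)) (fun l => Cseries u l).

Lemma Csum_correct (u : nat -> C) (M : R) : l1_le u M -> Cseries u (Csum u).
Proof. intros H; apply (epsilon_spec _ _ (l1_le_ex_series u M H)). Qed.

Lemma Cseries_unique (u : nat -> C) (l l' : C) : Cseries u l -> Cseries u l' -> l = l'.
Proof. exact (filterlim_locally_unique (V := C_NormedModule) _ l l'). Qed.

(** Lower semicontinuity of the l1 norm under coordinatewise convergence: the window of coordinates
    is finite, so the limit passes through the sum. *)
Lemma sum_n_Cmod_lim_le (x : nat -> nat -> C) (y : nat -> C) (N : nat) (M : R) :
  (forall m, filterlim (fun k => x k m) eventually (@locally C_UniformSpace (y m))) ->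
  (forall k, sum_n (fun m => Cmod (x k m)) N <= M) ->
  sum_n (fun m => Cmod (y m)) N <= M.
Proof.
  intros Hl Hb.
  assert (Hm : forall m, is_lim_seq (fun k => Cmod (x k m)) (Cmod (y m))).
  { intros m. exact (filterlim_comp _ _ _ _ _ _ _ _ (Hl m) (filterlim_norm (V := C_NormedModule) (y m))). }
  assert (Hs : is_lim_seq (fun k => sum_n (fun m => Cmod (x k m)) N) (sum_n (fun m => Cmod (y m)) N)).
  { clear Hb; induction N as [|N IH].
    - rewrite sum_O. apply (is_lim_seq_ext (fun k => Cmod (x k 0%nat))); [|apply Hm].
      intros k; rewrite sum_O; reflexivity.
    - rewrite sum_Sn. apply (is_lim_seq_ext (fun k => sum_n (fun m => Cmod (x k m)) N + Cmod (x k (S N)))).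
      { intros k; rewrite sum_Sn; reflexivity. }
      apply (is_lim_seq_plus' _ _ _ _ IH (Hm (S N))). }
  exact (is_lim_seq_le _ _ _ _ Hb Hs (is_lim_seq_const M)).
Qed.

Lemma Cseries_Cmod_le (u : nat -> C) (l : C) (M : R) :
  Cseries u l -> l1_le u M -> Cmod l <= M.
Proof.
  intros Hl Hb.
  assert (H := sum_n_Cmod_lim_le (fun k _ => sum_n u k) (fun _ => l) 0 M (fun _ => Hl)).
  rewrite sum_O in H; apply H. intros k; rewrite sum_O.
  eapply Rle_trans; [apply Cmod_sum_n_le | apply Hb].
Qed.

Lemma l1_le_mult (c u : nat -> C) (q M : R) :
  (forall i, Cmod (c i) <= q) -> l1_le u M -> l1_le (fun i => c i * u i)%C (q * M).
Proof.
  intros Hc Hu N.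
  assert (Hq : 0 <= q) by (eapply Rle_trans; [apply Cmod_ge_0 | apply (Hc 0%nat)]).
  eapply Rle_trans.
  - apply (sum_n_le_loc _ (fun i => q * Cmod (u i))). intros i _. rewrite Cmod_mult.
    apply Rmult_le_compat_r; [apply Cmod_ge_0 | apply Hc].
  - rewrite sum_n_scal_R. apply Rmult_le_compat_l; [exact Hq | apply Hu].
Qed.

Lemma l1_le_plus (u v : nat -> C) (M M' : R) :
  l1_le u M -> l1_le v M' -> l1_le (fun i => u i + v i)%C (M + M').
Proof.
  intros Hu Hv N. eapply Rle_trans.
  - apply (sum_n_le_loc _ (fun i => Cmod (u i) + Cmod (v i))). intros; apply Cmod_triangle.
  - rewrite sum_n_plus_R. apply Rplus_le_compat; auto.
Qed.

Lemma Cseries_plus (u v : nat -> C) (a b : C) :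
  Cseries u a -> Cseries v b -> Cseries (fun i => u i + v i)%C (a + b)%C.
Proof. exact (is_series_plus (V := C_NormedModule) u v a b). Qed.

Lemma Cseries_scal (c : C) (u : nat -> C) (a : C) :
  Cseries u a -> Cseries (fun i => c * u i)%C (c * a)%C.
Proof. exact (is_series_scal (V := C_NormedModule) c u a). Qed.

(** The operator norm on l1 is governed by column sums. Truncating the inner series at [k] makes
    both sums finite and interchangeable, and the bound survives the limit in [k]. *)
Lemma l1_le_matrix (B : nat -> nat -> C) (q M : R) (u v : nat -> C) :
  (forall i N, sum_n (fun m => Cmod (B m i)) N <= q) -> l1_le u M ->
  (forall m, Cseries (fun i => B m i * u i)%C (v m)) -> l1_le v (q * M).
Proof.
  intros HB Hu Hv N.
  assert (Hq : 0 <= q).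
  { eapply Rle_trans; [|apply (HB 0%nat 0%nat)]. apply sum_n_nonneg; intros; apply Cmod_ge_0. }
  apply (sum_n_Cmod_lim_le (fun k m => sum_n (fun i => B m i * u i)%C k) v N _ Hv).
  intros k. eapply Rle_trans.
  - apply (sum_n_le_loc _ (fun m => sum_n (fun i => Cmod (B m i) * Cmod (u i)) k)).
    intros m _. eapply Rle_trans; [apply Cmod_sum_n_le|].
    right; apply sum_n_ext; intros; apply Cmod_mult.
  - rewrite sum_n_switch.
    eapply Rle_trans; [apply (sum_n_le_loc _ (fun i => q * Cmod (u i)))|].
    + intros i _. rewrite (sum_n_ext _ (fun m => Cmod (u i) * Cmod (B m i))) by (intros; apply Rmult_comm).
      rewrite sum_n_scal_R, Rmult_comm. apply Rmult_le_compat_r; [apply Cmod_ge_0 | apply HB].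
    + rewrite sum_n_scal_R. apply Rmult_le_compat_l; [exact Hq | apply Hu].
Qed.

Lemma eq_of_Cmod_le_geom (x y : C) (A : R) :
  (forall k, Cmod (x - y) <= A * (/ 2) ^ k) -> x = y.
Proof.
  intros H.
  assert (H0 : Cmod (x - y) <= 0).
  { assert (Hl : is_lim_seq (fun k => A * (/ 2) ^ k) (A * 0)).
    { apply (is_lim_seq_scal_l _ A 0). apply is_lim_seq_geom. rewrite Rabs_pos_eq; lra. }
    rewrite Rmult_0_r in Hl.
    exact (is_lim_seq_le _ _ _ _ H (is_lim_seq_const _) Hl). }
  assert (H1 := Cmod_ge_0 (x - y)).
  assert (E : (x - y = 0)%C) by (apply Cmod_eq_0; lra).
  replace x with (x - y + y)%C by ring. rewrite E; ring.
Qed.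

Fixpoint neumann_term (B : nat -> nat -> C) (f : nat -> C) (k : nat) : nat -> C :=
  match k with
  | O => f
  | S k' => fun m => Csum (fun i => B m i * neumann_term B f k' i)%C
  end.

Lemma sum_geom_half_le (A : R) (k d : nat) :
  0 <= A -> sum_n (fun l => A * (/ 2) ^ (k + l)) d <= 2 * A * (/ 2) ^ k.
Proof.
  intros HA.
  assert (H : sum_n (fun l => A * (/ 2) ^ (k + l)) d
              = 2 * A * (/ 2) ^ k - A * (/ 2) ^ (k + d)).
  { induction d as [|d IH].
    - rewrite sum_O, Nat.add_0_r. in_R. ring.
    - rewrite sum_Sn, IH. in_R. rewrite Nat.add_succ_r; simpl. field. }
  rewrite H. assert (0 <= A * (/ 2) ^ (k + d)) by (apply Rmult_le_pos; [|apply pow_le]; lra). lra.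
Qed.

Lemma l1_le_sum (u : nat -> nat -> C) (b : nat -> R) (d : nat) :
  (forall l, l1_le (u l) (b l)) -> l1_le (fun m => sum_n (fun l => u l m) d) (sum_n b d).
Proof.
  intros H N. eapply Rle_trans.
  - apply (sum_n_le_loc _ (fun m => sum_n (fun l => Cmod (u l m)) d)); intros; apply Cmod_sum_n_le.
  - rewrite sum_n_switch. apply sum_n_le_loc. intros l _; apply H.
Qed.

(** Neumann series: [g = sum_k B^k f] solves [g = f + B g]. The equation is reached one coordinate
    at a time, by comparing both sides with the partial sums [s k]. *)
Lemma l1_contraction_solution (B : nat -> nat -> C) (f : nat -> C) (A : R) :
  (forall i N, sum_n (fun m => Cmod (B m i)) N <= / 2) -> l1_le f A ->
  exists g M, l1_le g M /\ forall m, Cseries (fun i => B m i * g i)%C (g m - f m)%C.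
Proof.
  intros HB Hf. set (u := neumann_term B f).
  assert (HA := l1_le_pos _ _ Hf).
  assert (HBt : forall m i, Cmod (B m i) <= / 2).
  { intros m i. eapply Rle_trans; [|apply (HB i m)].
    apply (term_le_sum_n (fun m => Cmod (B m i))); auto using Cmod_ge_0. }
  assert (Hu : forall k, l1_le (u k) (A * (/ 2) ^ k)).
  { induction k as [|k IH].
    - rewrite pow_O, Rmult_1_r. exact Hf.
    - replace (A * (/ 2) ^ S k) with (/ 2 * (A * (/ 2) ^ k)) by (simpl; ring).
      apply (l1_le_matrix B _ _ (u k)); auto.
      intros m. apply (Csum_correct _ (/ 2 * (A * (/ 2) ^ k))). apply l1_le_mult; auto. }
  assert (Hus : forall k m, Cseries (fun i => B m i * u k i)%C (u (S k) m)).
  { intros k m. apply (Csum_correct _ (/ 2 * (A * (/ 2) ^ k))). apply l1_le_mult; auto. }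
  set (g := fun m => Csum (fun k => u k m)).
  assert (Hg : forall m, Cseries (fun k => u k m) (g m)).
  { intros m. apply (Csum_correct _ (2 * A * (/ 2) ^ 0)). intros N.
    eapply Rle_trans; [|apply (sum_geom_half_le A 0 N HA)].
    apply sum_n_le_loc; intros l _. simpl. apply l1_le_term, Hu. }
  set (s := fun k m => sum_n (fun l => u l m) k : C).
  (* The tail starts at [S k], so the geometric bound [2 * A * (/ 2) ^ S k] is [A * (/ 2) ^ k]. *)
  assert (Hr : forall k, l1_le (fun m => g m - s k m)%C (A * (/ 2) ^ k)).
  { intros k N.
    apply (sum_n_Cmod_lim_le (fun d m => sum_n (fun l => u (S k + l)%nat m) d)).
    - intros m.
      assert (H := is_series_incr_n (V := C_NormedModule) (fun l => u l m) (S k)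
                     (g m - s k m)%C (Nat.lt_0_succ k)).
      apply H. clear H.
      replace (plus _ _) with (g m); [apply Hg|].
      change (g m = g m - s k m + s k m)%C. ring.
    - intros d. eapply Rle_trans.
      + apply (l1_le_sum (fun l m => u (S k + l)%nat m) (fun l => A * (/ 2) ^ (S k + l))).
        intros l; apply Hu.
      + eapply Rle_trans; [apply sum_geom_half_le, HA|]. simpl. lra. }
  (* Applying [B] shifts the series by one term: [B s_k = s_(k+1) - f]. *)
  assert (Hs : forall k m, Cseries (fun i => B m i * s k i)%C (s (S k) m - f m)%C).
  { unfold s. intros k m. induction k as [|k IH].
    - replace (sum_n (fun l => u l m) 1 - f m)%C with (u 1%nat m).
      + apply (is_series_ext (V := C_NormedModule) (fun i => B m i * u 0%nat i)%C); [|apply Hus].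
        intros i; rewrite sum_O; reflexivity.
      + rewrite sum_Sn, sum_O. change (u 1%nat m = f m + u 1%nat m - f m)%C. ring.
    - rewrite sum_Sn.
      apply (is_series_ext (V := C_NormedModule)
        (fun i => B m i * sum_n (fun l => u l i) k + B m i * u (S k) i)%C).
      + intros i; rewrite sum_Sn. change (B m i * s k i + B m i * u (S k) i = B m i * (s k i + u (S k) i))%C. ring.
      + replace (plus (sum_n (fun l => u l m) (S k)) (u (S (S k)) m) - f m)%C
          with (sum_n (fun l => u l m) (S k) - f m + u (S (S k)) m)%C
          by (change (s (S k) m - f m + u (S (S k)) m = s (S k) m + u (S (S k)) m - f m)%C; ring).
        apply Cseries_plus; [exact IH | apply Hus]. }
  (* One [A] for the tail [g - s 0], one for [s 0 = f]. *)
  assert (HgM : l1_le g (A + A)).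
  { intros N. eapply Rle_trans; [|apply (l1_le_plus (fun m => g m - s 0%nat m)%C (s 0%nat) A A)].
    - apply sum_n_le_loc. intros m _. right. f_equal. ring.
    - intros N'. assert (H := Hr 0%nat N'). rewrite pow_O, Rmult_1_r in H. exact H.
    - intros N'. rewrite (sum_n_ext _ (fun i => Cmod (f i))); [apply Hf|].
      intros i; unfold s; rewrite sum_O; reflexivity. }
  exists g, (A + A). split; [exact HgM|]. intros m.
  assert (HBg : l1_le (fun i => B m i * g i)%C (/ 2 * (A + A))) by (apply l1_le_mult; auto).
  assert (Hy := Csum_correct _ _ HBg).
  set (y := Csum _) in Hy.
  replace (g m - f m)%C with y; [exact Hy|].
  apply (eq_of_Cmod_le_geom _ _ A). intros k.
  (* The errors [B (g - s_k)] and [g - s_(k+1)] contribute [A * (/ 2) ^ (k + 1)] each. *)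
  assert (Hd : Cmod (y - (s (S k) m - f m)) <= / 2 * (A * (/ 2) ^ k)).
  { apply (Cseries_Cmod_le (fun i => B m i * (g i - s k i))%C).
    - apply (is_series_ext (V := C_NormedModule) (fun i => B m i * g i + (- (1)) * (B m i * s k i))%C).
      + intros i. in_C. ring.
      + replace (y - (s (S k) m - f m))%C with (y + (- (1)) * (s (S k) m - f m))%C by ring.
        apply Cseries_plus; [exact Hy|]. apply Cseries_scal, Hs.
    - apply l1_le_mult; auto. }
  assert (He : Cmod (g m - s (S k) m) <= A * (/ 2) ^ S k) by (exact (l1_le_term _ _ m (Hr (S k)))).
  replace (y - (g m - f m))%C with ((y - (s (S k) m - f m)) + - (g m - s (S k) m))%C by ring.
  eapply Rle_trans; [apply Cmod_triangle|]. rewrite Cmod_opp.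
  simpl pow in He. lra.
Qed.

(** * Underdetermined systems and the count of distinct equations *)

Lemma sum_n_scal_C (c : C) (u : nat -> C) (N : nat) :
  sum_n (fun i => c * u i)%C N = (c * sum_n u N)%C.
Proof. exact (sum_n_mult_l (K := C_Ring) c u N). Qed.

Lemma sum_n_plus_C (u v : nat -> C) (N : nat) :
  sum_n (fun i => u i + v i)%C N = (sum_n u N + sum_n v N)%C.
Proof. exact (sum_n_plus (G := C_AbelianMonoid) u v N). Qed.

Lemma sum_n_0_C (u : nat -> C) (N : nat) :
  (forall i, (i <= N)%nat -> u i = RtoC 0) -> sum_n u N = RtoC 0.
Proof.
  intros H; induction N as [|N IH].
  - rewrite sum_O; auto.
  - rewrite sum_Sn, IH, H by auto. change (0 + 0 = 0)%C. ring.
Qed.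

(** [sum_n] up to [n] has [n + 1] terms, so there is one more unknown than equations. Gaussian
    elimination: a row [r0] with nonzero last coefficient removes the last unknown from the other
    rows; without such a row the last unit vector is a solution. *)
Lemma underdetermined_system (n : nat) (L : list (nat -> C)) :
  length L = n ->
  exists x : nat -> C, (exists s, (s <= n)%nat /\ x s <> RtoC 0) /\
    forall r, In r L -> sum_n (fun s => r s * x s)%C n = RtoC 0.
Proof.
  revert L; induction n as [|n IH]; intros L HL.
  - exists (fun _ => RtoC 1). split.
    + exists 0%nat; split; [lia | exact C1_nz].
    + destruct L; [intros r [] | discriminate].
  - destruct (classic (exists r, In r L /\ r (S n) <> RtoC 0)) as [[r0 [Hin Hp]]|Hno].
    + destruct (in_split _ _ Hin) as [l1 [l2 ->]].
      destruct (IH (map (fun r s => r s - r (S n) / r0 (S n) * r0 s)%C (l1 ++ l2)))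
        as [x [[s0 [Hs0 Hx0]] Hx]].
      { rewrite length_map. rewrite length_app in *. simpl in HL. lia. }
      (* Back substitution: the last unknown takes the value that row [r0] forces. *)
      set (X := fun s => if (s <=? n)%nat then x s
                         else (- (sum_n (fun s => r0 s * x s)%C n) / r0 (S n))%C).
      assert (HX : forall r, sum_n (fun s => r s * X s)%C (S n)
        = (sum_n (fun s => r s * x s)%C n
           - r (S n) / r0 (S n) * sum_n (fun s => r0 s * x s)%C n)%C).
      { intros r. rewrite sum_Sn.
        rewrite (sum_n_ext_loc _ (fun s => r s * x s)%C).
        - unfold X. rewrite (proj2 (Nat.leb_gt (S n) n)) by lia.
          match goal with |- @eq _ (plus ?a ?b) ?c => change (Cplus a b = c) end.
          field. exact Hp.
        - intros s Hs. unfold X. rewrite (proj2 (Nat.leb_le s n)) by lia. reflexivity. }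
      exists X. split.
      * exists s0. split; [lia|]. unfold X. rewrite (proj2 (Nat.leb_le s0 n)) by lia. exact Hx0.
      * intros r Hr. rewrite HX.
        destruct (classic (r = r0)) as [->|Hne]; [in_C; field; exact Hp|].
        assert (Hr' : In r (l1 ++ l2)).
        { apply in_app_or in Hr. apply in_or_app. destruct Hr as [Hr|[Hr|Hr]]; auto.
          exfalso; apply Hne; symmetry; exact Hr. }
        rewrite <- (Hx _ (in_map (fun r s => r s - r (S n) / r0 (S n) * r0 s)%C _ _ Hr')).
        rewrite <- sum_n_scal_C.
        rewrite (sum_n_ext (fun s => (r s - r (S n) / r0 (S n) * r0 s) * x s)%C
          (fun s => r s * x s + (- (1)) * (r (S n) / r0 (S n) * (r0 s * x s)))%C)
          by (intros; in_C; ring).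
        rewrite sum_n_plus_C, (sum_n_scal_C (- (1))). in_C; ring.
    + exists (fun s => if Nat.eq_dec s (S n) then RtoC 1 else RtoC 0). split.
      * exists (S n). split; [lia|]. destruct (Nat.eq_dec (S n) (S n)); [exact C1_nz | lia].
      * intros r Hr. apply sum_n_0_C. intros s Hs.
        destruct (Nat.eq_dec s (S n)) as [->|Hne]; [|ring].
        destruct (classic (r (S n) = RtoC 0)) as [->|Hnz]; [ring|].
        exfalso; apply Hno; exists r; auto.
Qed.

Lemma count_lt_mono (P : nat -> Prop) (N N' : nat) :
  (N <= N')%nat -> (count_lt P N <= count_lt P N')%nat.
Proof. intros H; induction H; simpl; lia. Qed.

Lemma count_lt_0 (P : nat -> Prop) (N : nat) :
  (forall j, (j < N)%nat -> ~ P j) -> count_lt P N = 0%nat.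
Proof.
  intros H; induction N as [|N IH]; simpl; [reflexivity|].
  rewrite IH by (intros; apply H; lia).
  destruct (excluded_middle_informative (P N)) as [HP|]; [|reflexivity].
  exfalso; exact (H N (Nat.lt_succ_diag_r N) HP).
Qed.

Lemma sum_lt_le (P : nat -> Prop) (f f' : nat -> nat) (N N' : nat) :
  (N <= N')%nat -> (forall k, (k < N)%nat -> P k -> (f k <= f' k)%nat) ->
  (sum_lt P f N <= sum_lt P f' N')%nat.
Proof.
  intros HN; induction HN as [|N' HN IH]; intros H.
  - induction N as [|N IH]; simpl; [lia|].
    assert (sum_lt P f N <= sum_lt P f' N)%nat by (apply IH; intros; apply H; auto; lia).
    destruct (excluded_middle_informative (P N)) as [HP|]; [|lia].
    assert (f N <= f' N)%nat by (apply H; auto). lia.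
  - simpl. specialize (IH H). lia.
Qed.

(** [Q] marks the terms that may grow, and it holds at most once on [P]. Below, [Q] says that the
    appended index carries the value of class [k], so only one multiplicity can rise. *)
Lemma sum_lt_le_S (P Q : nat -> Prop) (f f' : nat -> nat) (N : nat) :
  (forall k, P k -> (f' k <= f k + 1)%nat) ->
  (forall k, P k -> ~ Q k -> (f' k <= f k)%nat) ->
  (forall k k', P k -> Q k -> P k' -> Q k' -> k = k') ->
  (sum_lt P f' N <= sum_lt P f N + 1)%nat.
Proof.
  intros H1 H0 Hu; induction N as [|N IH]; simpl; [lia|].
  destruct (excluded_middle_informative (P N)) as [HP|]; [|lia].
  destruct (classic (Q N)) as [HQ|HQ].
  - assert (sum_lt P f' N <= sum_lt P f N)%nat.
    { apply sum_lt_le; [lia|]. intros k Hk HPk. apply H0; [exact HPk|].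
      intros HQk. assert (k = N) by (apply Hu; auto). lia. }
    specialize (H1 N HP). lia.
  - specialize (H0 N HP HQ). lia.
Qed.

(** Unlike in [in_I], only earlier indices with nonzero weight compete. A value first met at an
    index with [alpha = 0] has no representative in [in_I], yet it imposes an equation if it recurs
    with nonzero weight, and so must be listed. *)
Definition new_value (lam alpha : nat -> C) (n : nat) : Prop :=
  alpha n <> CR 0 /\ forall j, (j < n)%nat -> alpha j <> CR 0 -> lam j <> lam n.

Fixpoint new_values (lam alpha : nat -> C) (N : nat) : list nat :=
  match N with
  | O => nil
  | S N' => if excluded_middle_informative (new_value lam alpha N')
            then N' :: new_values lam alpha N' else new_values lam alpha N'
  end.

Lemma in_new_values (lam alpha : nat -> C) (N n : nat) : (n < N)%nat -> new_value lam alpha n -> In n (new_values lam alpha N).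
Proof.
  intros Hn Hv; induction N as [|N IH]; [lia|]. simpl.
  destruct (Nat.eq_dec n N) as [->|Hne].
  - destruct (excluded_middle_informative (new_value lam alpha N)); [left; reflexivity | contradiction].
  - destruct (excluded_middle_informative (new_value lam alpha N)); [right|]; apply IH; lia.
Qed.

Lemma new_values_cover (lam alpha : nat -> C) (N n : nat) :
  (n < N)%nat -> alpha n <> CR 0 -> exists k, In k (new_values lam alpha N) /\ lam k = lam n.
Proof.
  induction n as [n IH] using (well_founded_induction Nat.lt_wf_0). intros Hn Ha.
  destruct (classic (new_value lam alpha n)) as [Hv|Hv].
  - exists n; split; [apply in_new_values; auto | reflexivity].
  - assert (Hj : exists j, (j < n)%nat /\ alpha j <> CR 0 /\ lam j = lam n).
    { apply NNPP; intros Hno; apply Hv; split; [exact Ha|].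
      intros j Hj Haj Hl; apply Hno; exists j; auto. }
    destruct Hj as [j [Hj [Haj Hl]]].
    destruct (IH j Hj) as [k [Hk Hkl]]; [lia | exact Haj |].
    exists k; split; [exact Hk | congruence].
Qed.

(** Each further index is paid for once: a zero weight raises A, a new value lengthens the list, a
    repeated value raises at most one term of B by one. Equality can fail, because B ignores
    repetitions of values without a representative in [in_I]. *)
Lemma length_new_values (lam alpha : nat -> C) (N : nat) :
  (length (new_values lam alpha N) + A_trunc alpha N + B_trunc lam alpha N <= N)%nat.
Proof.
  induction N as [|N IH]; [reflexivity|].
  unfold A_trunc, B_trunc, m_trunc in *. simpl.
  set (f := fun k => (count_lt (fun j => lam j = lam k /\ alpha j <> CR 0) N - 1)%nat) in IH.
  set (f' := fun k => (count_lt (fun j => lam j = lam k /\ alpha j <> CR 0) N +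
               (if excluded_middle_informative (lam N = lam k /\ alpha N <> CR 0) then 1 else 0) - 1)%nat).
  change (sum_lt (in_I lam alpha) (fun k => _) N) with (sum_lt (in_I lam alpha) f' N).
  assert (Hlast : in_I lam alpha N ->
    count_lt (fun j => lam j = lam N /\ alpha j <> CR 0) N = 0%nat).
  { intros [HI _]. apply count_lt_0. intros j Hj [Hl _]. exact (HI j Hj Hl). }
  (* The appended index opens its class with multiplicity one, so its own term is [1 - 1]. *)
  assert (HfN : in_I lam alpha N -> f' N = 0%nat).
  { intros HI. unfold f'. rewrite (Hlast HI).
    destruct (excluded_middle_informative (lam N = lam N /\ alpha N <> CR 0)); lia. }
  assert (Hlt : (if excluded_middle_informative (in_I lam alpha N) then f' N else 0)%nat = 0%nat).
  { destruct (excluded_middle_informative (in_I lam alpha N)); auto. }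
  unfold f' in Hlt at 1. rewrite Hlt.
  destruct (excluded_middle_informative (alpha N = CR 0)) as [Ha|Ha].
  - destruct (excluded_middle_informative (new_value lam alpha N)) as [[Hv _]|_]; [contradiction|].
    assert (sum_lt (in_I lam alpha) f' N <= sum_lt (in_I lam alpha) f N)%nat.
    { apply sum_lt_le; [lia|]. intros k _ _. unfold f', f.
      destruct (excluded_middle_informative (lam N = lam k /\ alpha N <> CR 0)) as [[_ Hc]|]; [contradiction|lia]. }
    lia.
  - destruct (excluded_middle_informative (new_value lam alpha N)) as [[_ Hv]|Hv].
    + assert (sum_lt (in_I lam alpha) f' N <= sum_lt (in_I lam alpha) f N)%nat.
      { apply sum_lt_le; [lia|]. intros k Hk [_ HIk]. unfold f', f.
        destruct (excluded_middle_informative (lam N = lam k /\ alpha N <> CR 0)) as [[Hl _]|]; [|lia].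
        exfalso; exact (Hv k Hk HIk (eq_sym Hl)). }
      simpl; lia.
    + assert (sum_lt (in_I lam alpha) f' N <= sum_lt (in_I lam alpha) f N + 1)%nat.
      { apply (sum_lt_le_S _ (fun k => lam N = lam k)).
        - intros k _. unfold f', f. destruct (excluded_middle_informative (lam N = lam k /\ alpha N <> CR 0)); lia.
        - intros k _ Hk. unfold f', f.
          destruct (excluded_middle_informative (lam N = lam k /\ alpha N <> CR 0)) as [[Hl _]|]; [contradiction|lia].
        (* Two first occurrences of the same value coincide. *)
        - intros k k' [Hk _] Hq [Hk' _] Hq'.
          destruct (Nat.lt_total k k') as [Hlt'|[He|Hlt']]; [|exact He|].
          + exfalso; apply (Hk' k Hlt'); congruence.
          + exfalso; apply (Hk k' Hlt'); congruence. }
      lia.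
Qed.

Lemma AB_trunc_mono (lam alpha : nat -> C) (N N' : nat) :
  (N <= N')%nat ->
  (A_trunc alpha N + B_trunc lam alpha N <= A_trunc alpha N' + B_trunc lam alpha N')%nat.
Proof.
  intros H. apply Nat.add_le_mono; [apply count_lt_mono, H|].
  apply sum_lt_le; [exact H|]. intros k _ _. apply Nat.sub_le_mono_r, count_lt_mono, H.
Qed.

(** * The integral of [cos (z t)] over [[0, PI]] *)

Lemma Cmod_le_intro (z : C) (B : R) :
  0 <= B -> fst z ^ 2 + snd z ^ 2 <= B ^ 2 -> Cmod z <= B.
Proof.
  intros HB H. unfold Cmod. rewrite <- (sqrt_pow2 B HB). apply sqrt_le_1_alt, H.
Qed.

Lemma Rabs_snd_le_Cmod (z : C) : Rabs (snd z) <= Cmod z.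
Proof. eapply Rle_trans; [apply Rmax_r | apply Rmax_Cmod]. Qed.

Lemma Rabs_fst_le_Cmod (z : C) : Rabs (fst z) <= Cmod z.
Proof. eapply Rle_trans; [apply Rmax_l | apply Rmax_Cmod]. Qed.

Lemma cosh_plus (x y : R) : cosh (x + y) = cosh x * cosh y + sinh x * sinh y.
Proof. unfold cosh, sinh. rewrite Ropp_plus_distr, !exp_plus. field. Qed.

Lemma sinh_plus (x y : R) : sinh (x + y) = sinh x * cosh y + cosh x * sinh y.
Proof. unfold cosh, sinh. rewrite Ropp_plus_distr, !exp_plus. field. Qed.

Lemma cosh_opp (x : R) : cosh (- x) = cosh x.
Proof. unfold cosh. rewrite Ropp_involutive. field. Qed.

Lemma sinh_opp (x : R) : sinh (- x) = - sinh x.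
Proof. unfold sinh. rewrite Ropp_involutive. field. Qed.

Lemma cosh_sinh_sqr (x : R) : cosh x ^ 2 = 1 + sinh x ^ 2.
Proof.
  unfold cosh, sinh. assert (H : exp x * exp (- x) = 1).
  { rewrite <- exp_plus, Rplus_opp_r. apply exp_0. }
  nra.
Qed.

Lemma exp_le (x y : R) : x <= y -> exp x <= exp y.
Proof. intros [H| ->]; [left; apply exp_increasing, H | right; reflexivity]. Qed.

Lemma cosh_le_exp (y : R) : 0 <= cosh y <= exp (Rabs y).
Proof.
  assert (H1 := exp_pos y). assert (H2 := exp_pos (- y)).
  assert (H3 := exp_le _ _ (Rle_abs y)). assert (H4 := exp_le _ _ (Rle_abs (- y))).
  rewrite Rabs_Ropp in H4. unfold cosh. lra.
Qed.

(** Multiplying [1 - 2 y <= exp (- 2 y)] by [exp y] gives [exp y - exp (- y) <= 2 y exp y]. *)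
Lemma sinh_nonneg_le (y : R) : 0 <= y -> 0 <= sinh y <= y * exp y.
Proof.
  intros Hy. assert (H : 1 - 2 * y <= exp (- y) * exp (- y)).
  { rewrite <- exp_plus. replace (- y + - y) with (- 2 * y) by ring.
    assert (H := exp_ineq1_le (-2 * y)). lra. }
  assert (H1 : exp y * exp (- y) = 1) by (rewrite <- exp_plus, Rplus_opp_r; apply exp_0).
  assert (H2 := exp_pos y). assert (H4 := exp_le (- y) y ltac:(lra)).
  unfold sinh. split; [lra|].
  assert (H5 : exp y * (1 - 2 * y) <= exp y * (exp (- y) * exp (- y))) by (apply Rmult_le_compat_l; lra).
  rewrite <- Rmult_assoc, H1 in H5. lra.
Qed.

Lemma Rabs_sinh_le (y : R) : Rabs (sinh y) <= Rabs y * exp (Rabs y).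
Proof.
  destruct (Rle_dec 0 y) as [Hy|Hy].
  - rewrite (Rabs_pos_eq y Hy). destruct (sinh_nonneg_le y Hy). rewrite Rabs_pos_eq; lra.
  - destruct (sinh_nonneg_le (- y)) as [H1 H2]; [lra|].
    rewrite <- (Rabs_Ropp (sinh y)), <- sinh_opp, <- (Rabs_Ropp y).
    rewrite (Rabs_pos_eq (- y)) by lra. rewrite Rabs_pos_eq; lra.
Qed.

Lemma Rabs_sin_le (x : R) : Rabs (sin x) <= Rabs x.
Proof.
  assert (Hp : forall x, 0 <= x -> Rabs (sin x) <= x).
  { clear x; intros x [Hx| <-]; [|rewrite sin_0, Rabs_R0; lra].
    apply Rabs_le. split.
    - destruct (Rle_dec x PI) as [H|H].
      + assert (H0 := sin_ge_0 x (Rlt_le _ _ Hx) H). lra.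
      + assert (H0 := SIN_bound x). assert (H1 := PI2_1). unfold PI2 in H1. lra.
    - left; apply sin_lt_x, Hx. }
  destruct (Rle_dec 0 x) as [Hx|Hx].
  - rewrite (Rabs_pos_eq x Hx). auto.
  - rewrite <- Rabs_Ropp, <- sin_neg, <- (Rabs_Ropp x), (Rabs_pos_eq (- x)) by lra. apply Hp; lra.
Qed.

Definition Csin (z : C) : C := (sin (fst z) * cosh (snd z), cos (fst z) * sinh (snd z)).

Lemma Cmod_Csin_le_exp (z : C) : Cmod (Csin z) <= exp (Rabs (snd z)).
Proof.
  destruct z as [x y]; unfold Csin; simpl fst; simpl snd.
  destruct (cosh_le_exp y) as [H0 H1].
  apply Rle_trans with (cosh y); [|exact H1].
  apply Cmod_le_intro; [exact H0|]; simpl fst; simpl snd.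
  assert (H2 := cosh_sinh_sqr y). assert (H3 := sin2_cos2 x). unfold Rsqr in H3.
  (* [|sin z|^2 = cosh^2 y - cos^2 x], hence the bound by [cosh y]. *)
  replace ((sin x * cosh y) ^ 2 + (cos x * sinh y) ^ 2)
    with ((sin x * sin x + cos x * cos x) * cosh y ^ 2 - cos x ^ 2 * (cosh y ^ 2 - sinh y ^ 2)) by ring.
  rewrite H3, H2. assert (H4 := pow2_ge_0 (cos x)). lra.
Qed.

Lemma Cmod_Csin_le (z : C) : Cmod (Csin z) <= exp (Rabs (snd z)) * Cmod z.
Proof.
  destruct z as [x y]; unfold Csin; simpl fst; simpl snd.
  set (e := exp (Rabs y)).
  assert (He : 0 < e) by apply exp_pos.
  apply Cmod_le_intro; [apply Rmult_le_pos; [lra | apply Cmod_ge_0]|]; simpl fst; simpl snd.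
  rewrite !Rpow_mult_distr, Cmod2_alt. simpl Re; simpl Im.
  assert (Hs : sin x ^ 2 <= x ^ 2).
  { rewrite <- (pow2_abs (sin x)), <- (pow2_abs x). apply pow_incr; split; [apply Rabs_pos | apply Rabs_sin_le]. }
  assert (Hc : cosh y ^ 2 <= e ^ 2) by (apply pow_incr, cosh_le_exp).
  assert (Hsh : sinh y ^ 2 <= y ^ 2 * e ^ 2).
  { rewrite <- (pow2_abs (sinh y)), <- (pow2_abs y), <- Rpow_mult_distr.
    apply pow_incr; split; [apply Rabs_pos | apply Rabs_sinh_le]. }
  assert (Hco : cos x ^ 2 <= 1).
  { assert (H3 := sin2_cos2 x). unfold Rsqr in H3. assert (H4 := pow2_ge_0 (sin x)). nra. }
  assert (H1 : sin x ^ 2 * cosh y ^ 2 <= x ^ 2 * e ^ 2)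
    by (apply Rmult_le_compat; auto using pow2_ge_0).
  assert (H2 : cos x ^ 2 * sinh y ^ 2 <= 1 * (y ^ 2 * e ^ 2))
    by (apply Rmult_le_compat; auto using pow2_ge_0).
  lra.
Qed.

Lemma Ccos_sub (s d : C) :
  (Ccos (s + d) - Ccos (s - d) = - (2) * (Csin s * Csin d))%C.
Proof.
  destruct s as [a b], d as [x y]; unfold Ccos, Csin, Cminus, Cplus, Copp, Cmult, RtoC; simpl.
  rewrite !cosh_plus, !sinh_plus, !cos_plus, !sin_plus, !cosh_opp, !sinh_opp, !cos_neg, !sin_neg.
  f_equal; ring.
Qed.

Lemma Cmod_Ccos_sub_le (s d : C) :
  Cmod (Ccos (s + d) - Ccos (s - d))
  <= 2 * (exp (Rabs (snd s)) * (exp (Rabs (snd d)) * Cmod d)).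
Proof.
  rewrite Ccos_sub, !Cmod_mult, Cmod_opp, Cmod_R, (Rabs_pos_eq 2) by lra.
  apply Rmult_le_compat_l; [lra|].
  apply Rmult_le_compat; auto using Cmod_ge_0, Cmod_Csin_le_exp, Cmod_Csin_le.
Qed.

(** This is [sin (PI z) / z] with the removable singularity at 0 filled in; [mult_Sint] gives the
    closed form without dividing. *)
Definition Sint (z : C) : C := CRInt (fun t => Ccos (z * CR t)) PI.

Lemma Ccos_scal_R (z : C) (t : R) :
  Ccos (z * CR t) = (cos (fst z * t) * cosh (snd z * t), - (sin (fst z * t) * sinh (snd z * t))).
Proof.
  unfold Ccos, CR, RtoC, Cmult; simpl.
  replace (fst z * t - snd z * 0) with (fst z * t) by ring.
  replace (fst z * 0 + snd z * t) with (snd z * t) by ring. reflexivity.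
Qed.

Definition Cint_ok (f : R -> C) : Prop :=
  ex_RInt (fun t => fst (f t)) 0 PI /\ ex_RInt (fun t => snd (f t)) 0 PI.

Lemma Cint_ok_cos (z : C) : Cint_ok (fun t => Ccos (z * CR t)).
Proof.
  split.
  - apply (ex_RInt_ext (fun t => cos (fst z * t) * cosh (snd z * t))).
    { intros t _; rewrite Ccos_scal_R; reflexivity. }
    apply (ex_RInt_continuous (V := R_CompleteNormedModule)). intros t _.
    apply (ex_derive_continuous (V := R_NormedModule)). auto_derive; auto.
  - apply (ex_RInt_ext (fun t => - (sin (fst z * t) * sinh (snd z * t)))).
    { intros t _; rewrite Ccos_scal_R; reflexivity. }
    apply (ex_RInt_continuous (V := R_CompleteNormedModule)). intros t _.
    apply (ex_derive_continuous (V := R_NormedModule)). auto_derive; auto.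
Qed.

(** The factor 2 is the price of bounding the real and imaginary integrals separately. *)
Lemma Cmod_CRInt_sub_le (f g : R -> C) (M : R) :
  Cint_ok f -> Cint_ok g -> (forall t, 0 <= t <= PI -> Cmod (f t - g t) <= M) ->
  Cmod (CRInt f PI - CRInt g PI) <= 2 * (PI * M).
Proof.
  intros [Hf1 Hf2] [Hg1 Hg2] H. assert (HPI := PI_RGT_0).
  assert (H1 : Rabs (fst (CRInt f PI - CRInt g PI)%C) <= PI * M).
  { unfold CRInt; simpl.
    replace (RInt (fun t => fst (f t)) 0 PI + - RInt (fun t => fst (g t)) 0 PI)
      with (RInt (fun t => fst (f t) - fst (g t)) 0 PI)
      by exact (RInt_minus (V := R_CompleteNormedModule) _ _ 0 PI Hf1 Hg1).
    replace (PI * M) with ((PI - 0) * M) by ring.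
    apply abs_RInt_le_const; [lra | exact (ex_RInt_minus (V := R_NormedModule) _ _ 0 PI Hf1 Hg1) |].
    intros t Ht. eapply Rle_trans; [apply (Rabs_fst_le_Cmod (f t - g t)) | auto]. }
  assert (H2 : Rabs (snd (CRInt f PI - CRInt g PI)%C) <= PI * M).
  { unfold CRInt; simpl.
    replace (RInt (fun t => snd (f t)) 0 PI + - RInt (fun t => snd (g t)) 0 PI)
      with (RInt (fun t => snd (f t) - snd (g t)) 0 PI)
      by exact (RInt_minus (V := R_CompleteNormedModule) _ _ 0 PI Hf2 Hg2).
    replace (PI * M) with ((PI - 0) * M) by ring.
    apply abs_RInt_le_const; [lra | exact (ex_RInt_minus (V := R_NormedModule) _ _ 0 PI Hf2 Hg2) |].
    intros t Ht. eapply Rle_trans; [apply (Rabs_snd_le_Cmod (f t - g t)) | auto]. }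
  assert (HM : 0 <= PI * M) by (eapply Rle_trans; [apply Rabs_pos | exact H1]).
  apply Cmod_le_intro; [lra|].
  rewrite <- (pow2_abs (fst _)), <- (pow2_abs (snd _)).
  assert (H3 := pow_incr _ _ 2 (conj (Rabs_pos _) H1)).
  assert (H4 := pow_incr _ _ 2 (conj (Rabs_pos _) H2)).
  nra.
Qed.

Lemma Sint_lipschitz (h : R) (z z' : C) :
  Rabs (snd z) <= h -> Rabs (snd z') <= h ->
  Cmod (Sint z - Sint z') <= 2 * (PI * (PI * (exp (2 * PI * h) * Cmod (z - z')))).
Proof.
  intros Hz Hz'. assert (HPI := PI_RGT_0).
  apply Cmod_CRInt_sub_le; try apply Cint_ok_cos.
  intros t Ht.
  (* With [s] and [d] half the sum and half the difference of the arguments, [Ccos_sub] isolates the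
     factor [z - z']. Both have imaginary part at most [PI * h], whence the exponential constant. *)
  set (s := ((z + z') * CR (t / 2))%C). set (d := ((z - z') * CR (t / 2))%C).
  assert (E2 : CR t = (2 * CR (t / 2))%C).
  { unfold CR. rewrite <- RtoC_mult. f_equal; field. }
  replace (z * CR t)%C with (s + d)%C by (unfold s, d; rewrite E2; ring).
  replace (z' * CR t)%C with (s - d)%C by (unfold s, d; rewrite E2; ring).
  assert (Hh : 0 <= h) by (eapply Rle_trans; [apply Rabs_pos | exact Hz]).
  assert (Ht2 : 0 <= t / 2) by lra.
  assert (Hs : Rabs (snd s) <= PI * h).
  { unfold s; simpl. replace ((fst z + fst z') * 0 + (snd z + snd z') * (t / 2))
      with ((snd z + snd z') * (t / 2)) by ring.
    rewrite Rabs_mult, (Rabs_pos_eq (t / 2) Ht2).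
    assert (H := Rabs_triang (snd z) (snd z')).
    assert (H0 := Rabs_pos (snd z + snd z')). nra. }
  assert (Hd : Rabs (snd d) <= PI * h).
  { unfold d; simpl. replace ((fst z + - fst z') * 0 + (snd z + - snd z') * (t / 2))
      with ((snd z + - snd z') * (t / 2)) by ring.
    rewrite Rabs_mult, (Rabs_pos_eq (t / 2) Ht2).
    assert (H := Rabs_triang (snd z) (- snd z')). rewrite Rabs_Ropp in H.
    assert (H0 := Rabs_pos (snd z + - snd z')). nra. }
  assert (Hdm : 2 * Cmod d <= PI * Cmod (z - z')).
  { unfold d, CR. rewrite Cmod_mult, Cmod_R, (Rabs_pos_eq (t / 2) Ht2).
    assert (H := Cmod_ge_0 (z - z')). nra. }
  eapply Rle_trans; [apply Cmod_Ccos_sub_le|].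
  assert (He : exp (Rabs (snd s)) * exp (Rabs (snd d)) <= exp (2 * PI * h)).
  { rewrite <- exp_plus. apply exp_le. lra. }
  assert (H0 := exp_pos (2 * PI * h)). assert (H1 := Cmod_ge_0 d).
  assert (H2 := exp_pos (Rabs (snd s))). assert (H3 := exp_pos (Rabs (snd d))).
  replace (2 * (exp (Rabs (snd s)) * (exp (Rabs (snd d)) * Cmod d)))
    with ((exp (Rabs (snd s)) * exp (Rabs (snd d))) * (2 * Cmod d)) by ring.
  replace (PI * (exp (2 * PI * h) * Cmod (z - z')))
    with (exp (2 * PI * h) * (PI * Cmod (z - z'))) by ring.
  apply Rmult_le_compat; nra.
Qed.

Lemma Sint_0 : Sint 0 = CR PI.
Proof.
  unfold Sint, CRInt, CR, RtoC. f_equal.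
  - rewrite (RInt_ext _ (fun _ => 1)).
    + rewrite RInt_const. change ((PI - 0) * 1 = PI). ring.
    + intros t _. unfold Ccos, Cmult; simpl. rewrite !Rmult_0_l, Rminus_0_r, Rplus_0_r, cos_0, cosh_0. ring.
  - rewrite (RInt_ext _ (fun _ => 0)).
    + rewrite RInt_const. change ((PI - 0) * 0 = 0). ring.
    + intros t _. unfold Ccos, Cmult; simpl. rewrite !Rmult_0_l, Rminus_0_r, sin_0. ring.
Qed.

(** Second order, where [Sint_lipschitz] gives only first: [cos (h t) - 1 = - 2 sin^2 (h t / 2)],
    which is [Ccos_sub] with [s = d]. *)
Lemma Sint_near_0 (h : C) :
  Cmod h <= 1 -> Cmod (Sint h - CR PI) <= PI * PI * PI * exp PI * Cmod h ^ 2.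
Proof.
  intros Hh. assert (HPI := PI_RGT_0). rewrite <- Sint_0.
  replace (PI * PI * PI * exp PI * Cmod h ^ 2)
    with (2 * (PI * (PI * PI / 2 * exp PI * Cmod h ^ 2))) by field.
  apply Cmod_CRInt_sub_le; try apply Cint_ok_cos.
  intros t Ht. set (d := (h * CR (t / 2))%C).
  assert (E2 : CR t = (2 * CR (t / 2))%C).
  { unfold CR. rewrite <- RtoC_mult. f_equal; field. }
  replace (h * CR t)%C with (d + d)%C by (unfold d; rewrite E2; ring).
  replace (0 * CR t)%C with (d - d)%C by ring.
  rewrite Ccos_sub, !Cmod_mult, Cmod_opp, Cmod_R, (Rabs_pos_eq 2) by lra.
  assert (Hdm : Cmod d <= PI / 2 * Cmod h).
  { unfold d, CR. rewrite Cmod_mult, Cmod_R, Rabs_pos_eq by lra.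
    assert (H := Cmod_ge_0 h). nra. }
  assert (Hs : Cmod (Csin d) <= exp (PI / 2) * (PI / 2 * Cmod h)).
  { eapply Rle_trans; [apply Cmod_Csin_le|].
    apply Rmult_le_compat; [left; apply exp_pos | apply Cmod_ge_0 | | exact Hdm].
    apply exp_le. eapply Rle_trans; [apply Rabs_snd_le_Cmod|]. nra. }
  assert (H1 : Cmod (Csin d) * Cmod (Csin d)
    <= (exp (PI / 2) * (PI / 2 * Cmod h)) * (exp (PI / 2) * (PI / 2 * Cmod h)))
    by (apply Rmult_le_compat; auto using Cmod_ge_0).
  replace (exp PI) with (exp (PI / 2) * exp (PI / 2)) by (rewrite <- exp_plus; f_equal; field).
  lra.
Qed.

(** [z cos (z t)] is the derivative of [sin (z t)]; the fundamental theorem of calculus is applied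
    to the real and imaginary parts. *)
Lemma mult_Sint (z : C) : (z * Sint z = Csin (CR PI * z))%C.
Proof.
  destruct (Cint_ok_cos z) as [H1 H2].
  set (a := fun t => fst (Ccos (z * CR t))) in H1.
  set (b := fun t => snd (Ccos (z * CR t))) in H2.
  assert (I1 := RInt_correct (V := R_CompleteNormedModule) _ _ _ H1).
  assert (I2 := RInt_correct (V := R_CompleteNormedModule) _ _ _ H2).
  destruct z as [x y].
  assert (Ea : forall t, a t = cos (x * t) * cosh (y * t))
    by (intros t; unfold a; rewrite Ccos_scal_R; reflexivity).
  assert (Eb : forall t, b t = - (sin (x * t) * sinh (y * t)))
    by (intros t; unfold b; rewrite Ccos_scal_R; reflexivity).
  assert (F1 : is_RInt (fun t => x * a t - y * b t) 0 PI (sin (x * PI) * cosh (y * PI))).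
  { replace (sin (x * PI) * cosh (y * PI))
      with (minus ((fun t => sin (x * t) * cosh (y * t)) PI) ((fun t => sin (x * t) * cosh (y * t)) 0)).
    2: { change (sin (x * PI) * cosh (y * PI) - sin (x * 0) * cosh (y * 0) = sin (x * PI) * cosh (y * PI)).
         rewrite Rmult_0_r, sin_0. ring. }
    apply (is_RInt_ext (fun t => x * (cos (x * t) * cosh (y * t)) - y * (- (sin (x * t) * sinh (y * t))))).
    { intros t _. rewrite Ea, Eb. reflexivity. }
    apply (is_RInt_derive (V := R_CompleteNormedModule) (fun t => sin (x * t) * cosh (y * t))).
    - intros t _. auto_derive; auto. ring.
    - intros t _. apply (ex_derive_continuous (V := R_NormedModule)). auto_derive; auto. }
  assert (F2 : is_RInt (fun t => x * b t + y * a t) 0 PI (cos (x * PI) * sinh (y * PI))).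
  { replace (cos (x * PI) * sinh (y * PI))
      with (minus ((fun t => cos (x * t) * sinh (y * t)) PI) ((fun t => cos (x * t) * sinh (y * t)) 0)).
    2: { change (cos (x * PI) * sinh (y * PI) - cos (x * 0) * sinh (y * 0) = cos (x * PI) * sinh (y * PI)).
         rewrite !Rmult_0_r, sinh_0. ring. }
    apply (is_RInt_ext (fun t => x * (- (sin (x * t) * sinh (y * t))) + y * (cos (x * t) * cosh (y * t)))).
    { intros t _. rewrite Ea, Eb. reflexivity. }
    apply (is_RInt_derive (V := R_CompleteNormedModule) (fun t => cos (x * t) * sinh (y * t))).
    - intros t _. auto_derive; auto. ring.
    - intros t _. apply (ex_derive_continuous (V := R_NormedModule)). auto_derive; auto. }
  assert (G1 := is_RInt_minus (V := R_NormedModule) _ _ _ _ _ _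
    (is_RInt_scal (V := R_NormedModule) _ _ _ x _ I1) (is_RInt_scal (V := R_NormedModule) _ _ _ y _ I2)).
  assert (G2 := is_RInt_plus (V := R_NormedModule) _ _ _ _ _ _
    (is_RInt_scal (V := R_NormedModule) _ _ _ x _ I2) (is_RInt_scal (V := R_NormedModule) _ _ _ y _ I1)).
  assert (K1 := eq_trans (eq_sym (is_RInt_unique (V := R_CompleteNormedModule) _ _ _ _ G1))
                         (is_RInt_unique (V := R_CompleteNormedModule) _ _ _ _ F1)).
  assert (K2 := eq_trans (eq_sym (is_RInt_unique (V := R_CompleteNormedModule) _ _ _ _ G2))
                         (is_RInt_unique (V := R_CompleteNormedModule) _ _ _ _ F2)).
  transitivity (sin (x * PI) * cosh (y * PI), cos (x * PI) * sinh (y * PI)).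
  - rewrite <- K1, <- K2. reflexivity.
  - unfold Csin, CR, RtoC, Cmult; simpl.
    replace (PI * x - 0 * y) with (x * PI) by ring.
    replace (PI * y + 0 * x) with (y * PI) by ring. reflexivity.
Qed.

Lemma Csin_shift (d : Z) (w : C) :
  Csin (CR (IZR d * PI) + w) = (CR (cos (IZR d * PI)) * Csin w)%C.
Proof.
  assert (Hs : sin (IZR d * PI) = 0) by (apply sin_eq_0_1; exists d; reflexivity).
  unfold Csin, CR, RtoC, Cplus, Cmult; simpl.
  rewrite sin_plus, cos_plus, Hs, Rplus_0_l. f_equal; ring.
Qed.

Lemma Rabs_cos_int (d : Z) : Rabs (cos (IZR d * PI)) = 1.
Proof.
  assert (Hs : sin (IZR d * PI) = 0) by (apply sin_eq_0_1; exists d; reflexivity).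
  assert (H := sin2_cos2 (IZR d * PI)). rewrite Hs in H.
  rewrite <- Rabs_R1. apply Rsqr_eq_abs_0. unfold Rsqr in *. lra.
Qed.

(** Periodicity of the sine moves the integer [d] to the origin. For [d <> 0] the factor [w] on the
    right yields both the zero of [Sint] at [d] and the decay in [d]. *)
Lemma mult_Sint_shift (d : Z) (w : C) :
  ((CR (IZR d) + w) * Sint (CR (IZR d) + w) = CR (cos (IZR d * PI)) * (w * Sint w))%C.
Proof.
  rewrite !mult_Sint, <- Csin_shift. f_equal. unfold CR. rewrite RtoC_mult. ring.
Qed.

Lemma Sint_int (d : Z) : d <> 0%Z -> Sint (CR (IZR d)) = RtoC 0.
Proof.
  intros Hd. assert (H := mult_Sint_shift d 0).
  rewrite Cplus_0_r, Cmult_0_l, Cmult_0_r in H.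
  apply (f_equal Cmod) in H. rewrite Cmod_mult, Cmod_0 in H.
  apply Rmult_integral in H. destruct H as [H|H]; [|apply Cmod_eq_0, H].
  exfalso; apply Hd, eq_IZR. exact (f_equal fst (Cmod_eq_0 _ H)).
Qed.

(** [|d| - 1/2 >= (1 + |d|) / 4] exactly when [|d| >= 1]. *)
Lemma Cmod_int_plus_ge (d : Z) (w : C) :
  d <> 0%Z -> Cmod w <= / 2 -> (1 + Rabs (IZR d)) / 4 <= Cmod (CR (IZR d) + w).
Proof.
  intros Hd Hw.
  assert (H1 : 1 <= Rabs (IZR d)) by (rewrite <- abs_IZR; apply IZR_le; lia).
  assert (H := Cmod_triangle (CR (IZR d) + w) (- w)).
  replace (CR (IZR d) + w + - w)%C with (CR (IZR d)) in H by ring.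
  rewrite Cmod_opp in H. unfold CR in H at 1. rewrite Cmod_R in H. lra.
Qed.

Lemma Sint_small_bound :
  exists B, 0 < B /\ forall w, Cmod w <= / 2 -> Cmod (Sint w) <= B.
Proof.
  assert (HPI := PI_RGT_0). assert (He := exp_pos PI).
  assert (HP : 0 < PI * PI * PI * exp PI) by (repeat (assumption || lra || apply Rmult_lt_0_compat)).
  exists (PI * PI * PI * exp PI + PI). split; [lra|]. intros w Hw.
  replace (Sint w) with ((Sint w - CR PI) + CR PI)%C by ring.
  eapply Rle_trans; [apply Cmod_triangle|].
  apply Rplus_le_compat; [|unfold CR; rewrite Cmod_R, Rabs_pos_eq; lra].
  eapply Rle_trans; [apply Sint_near_0; lra|].
  assert (H := Cmod_ge_0 w). assert (H2 : Cmod w ^ 2 <= 1) by nra. nra.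
Qed.

(** The factor [1 / (1 + |d|)] is square summable in [d], so it can be paired with an l2
    perturbation. At [d = 0] the shift identity is vacuous and the Lipschitz bound takes over. *)
Lemma Sint_decay :
  exists A, 0 < A /\ forall d w, Cmod w <= / 2 ->
    Cmod (Sint (CR (IZR d) + w) - Sint (CR (IZR d))) <= A * (Cmod w * / (1 + Rabs (IZR d))).
Proof.
  destruct Sint_small_bound as [B [HB HBw]].
  assert (HPI := PI_RGT_0). assert (He := exp_pos (2 * PI * / 2)).
  set (L := 2 * (PI * (PI * exp (2 * PI * / 2)))).
  assert (HL : 0 < L) by (unfold L; repeat (assumption || lra || apply Rmult_lt_0_compat)).
  exists (L + 4 * B). split; [lra|]. intros d w Hw.
  assert (H0 := Cmod_ge_0 w).
  destruct (Z.eq_dec d 0) as [->|Hd].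
  - rewrite Rabs_R0, Rplus_0_r, Rinv_1, Rmult_1_r.
    apply Rle_trans with (L * Cmod w); [|nra].
    eapply Rle_trans; [apply (Sint_lipschitz (/ 2))|].
    + simpl. rewrite Rplus_0_l. eapply Rle_trans; [apply Rabs_snd_le_Cmod | exact Hw].
    + simpl. rewrite Rabs_R0. lra.
    + replace (CR 0 + w - CR 0)%C with w by ring. unfold L. lra.
  - rewrite (Sint_int d Hd). replace (Sint (CR (IZR d) + w) - 0)%C with (Sint (CR (IZR d) + w)) by ring.
    assert (H1 := Cmod_int_plus_ge d w Hd Hw).
    assert (H2 := f_equal Cmod (mult_Sint_shift d w)).
    rewrite !Cmod_mult in H2. unfold CR at 3 in H2. rewrite Cmod_R, Rabs_cos_int in H2.
    assert (H3 := HBw w Hw). assert (H4 := Cmod_ge_0 (Sint (CR (IZR d) + w))).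
    assert (H5 := Rabs_pos (IZR d)).
    apply Rle_trans with (4 * B * (Cmod w * / (1 + Rabs (IZR d)))).
    + apply Rmult_le_reg_r with (1 + Rabs (IZR d)); [lra|].
      replace (4 * B * (Cmod w * / (1 + Rabs (IZR d))) * (1 + Rabs (IZR d)))
        with (4 * (Cmod w * B)) by (field; lra).
      assert (H6 : Cmod w * Cmod (Sint w) <= Cmod w * B) by (apply Rmult_le_compat_l; auto).
      assert (H7 : (1 + Rabs (IZR d)) / 4 * Cmod (Sint (CR (IZR d) + w))
        <= Cmod (CR (IZR d) + w) * Cmod (Sint (CR (IZR d) + w))) by (apply Rmult_le_compat_r; auto).
      lra.
    + apply Rmult_le_compat_r; [|lra]. apply Rmult_le_pos; [exact H0|].
      left; apply Rinv_0_lt_compat; lra.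
Qed.

(* The expansion at a nonzero integer is read off from
   [(d + h) Sint (d + h) = (-1)^d h Sint h] and [Sint h = PI + O(h^2)]. *)
Lemma Sint_expansion :
  exists A, 0 < A /\ forall d, exists s, Cmod s <= PI /\ forall h, Cmod h <= / 2 ->
    Cmod (Sint (CR (IZR d) + h) - Sint (CR (IZR d)) - h * s) <= A * Cmod h ^ 2.
Proof.
  assert (HPI := PI_RGT_0). assert (He := exp_pos PI).
  set (A0 := PI * PI * PI * exp PI).
  assert (HA0 : 0 < A0) by (unfold A0; repeat (assumption || lra || apply Rmult_lt_0_compat)).
  exists (2 * (A0 + PI)). split; [lra|]. intros d.
  destruct (Z.eq_dec d 0) as [->|Hd].
  - exists (RtoC 0). split; [rewrite Cmod_0; lra|]. intros h Hh.
    replace (Sint (CR 0 + h) - Sint (CR 0) - h * 0)%C with (Sint h - CR PI)%C.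
    + eapply Rle_trans; [apply Sint_near_0; lra|]. fold A0.
      apply Rmult_le_compat_r; [apply pow2_ge_0 | lra].
    + unfold CR at 2 3. rewrite Sint_0. unfold CR. rewrite Cplus_0_l. ring.
  - assert (Hd1 : 1 <= Rabs (IZR d)) by (rewrite <- abs_IZR; apply IZR_le; lia).
    assert (Hdz : IZR d <> 0) by (intros E; rewrite E, Rabs_R0 in Hd1; lra).
    assert (HdC : CR (IZR d) <> RtoC 0) by (intros E; apply Hdz; exact (f_equal fst E)).
    set (e := CR (cos (IZR d * PI))).
    assert (Hem : Cmod e = 1) by (unfold e, CR; rewrite Cmod_R; apply Rabs_cos_int).
    assert (Hdm : Cmod (CR (IZR d)) = Rabs (IZR d)) by (unfold CR; apply Cmod_R).
    assert (Hpm : Cmod (CR PI) = PI) by (unfold CR; rewrite Cmod_R; apply Rabs_pos_eq; lra).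
    assert (Hinv : / Rabs (IZR d) <= 1) by (rewrite <- Rinv_1; apply Rinv_le_contravar; lra).
    (* The slope is [(-1)^d PI / d]: the right side of the shift identity is [(-1)^d PI h] to first
       order. *)
    exists (e * CR PI / CR (IZR d))%C. split.
    + rewrite Cmod_div, Cmod_mult, Hem, Hdm, Hpm by exact HdC. unfold Rdiv. nra.
    + intros h Hh. rewrite (Sint_int d Hd).
      set (X := (Sint (CR (IZR d) + h) - 0 - h * (e * CR PI / CR (IZR d)))%C).
      assert (HX : ((CR (IZR d) + h) * X = e * h * ((Sint h - CR PI) + - (CR PI * h / CR (IZR d))))%C).
      { assert (H := mult_Sint_shift d h). fold e in H.
        transitivity ((CR (IZR d) + h) * Sint (CR (IZR d) + h) - (CR (IZR d) + h) * (h * (e * CR PI / CR (IZR d))))%C;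
          [unfold X; ring|]. rewrite H. field. exact HdC. }
      apply (f_equal Cmod) in HX. rewrite !Cmod_mult, Hem in HX.
      assert (H1 := Cmod_int_plus_ge d h Hd Hh).
      assert (H2 : Cmod ((Sint h - CR PI) + - (CR PI * h / CR (IZR d))) <= (A0 + PI) * Cmod h).
      { eapply Rle_trans; [apply Cmod_triangle|].
        rewrite Cmod_opp, Cmod_div, Cmod_mult, Hdm, Hpm by exact HdC.
        assert (H3 : Cmod (Sint h - CR PI) <= A0 * Cmod h ^ 2) by (apply Sint_near_0; lra).
        assert (H4 := Cmod_ge_0 h). unfold Rdiv.
        assert (H5 : PI * Cmod h * / Rabs (IZR d) <= PI * Cmod h * 1)
          by (apply Rmult_le_compat_l; nra).
        assert (H6 : A0 * Cmod h ^ 2 <= A0 * Cmod h) by (apply Rmult_le_compat_l; nra). lra. }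
      assert (H3 := Cmod_ge_0 X). assert (H4 := Cmod_ge_0 h).
      assert (H5 : / 2 * Cmod X <= Cmod (CR (IZR d) + h) * Cmod X) by (apply Rmult_le_compat_r; lra).
      assert (H6 : Cmod h * Cmod ((Sint h - CR PI) + - (CR PI * h / CR (IZR d)))
                   <= Cmod h * ((A0 + PI) * Cmod h)) by (apply Rmult_le_compat_l; auto).
      lra.
Qed.

(** * The kernel [K(r, i)] *)

(* [K(r, i)] in closed form; [Dt_Kc] identifies it with the integral. *)
Definition Kc (r : C) (i : nat) : C :=
  ((Sint (r - CR (INR i)) + Sint (r + CR (INR i))) / 2)%C.

Lemma Csqrt_sqr (r : C) : Csqrt (r * r) = r \/ Csqrt (r * r) = (- r)%C.
Proof.
  assert (Hex : exists q, sqrt_branch (r * r) q).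
  { destruct r as [x y]. destruct (Rlt_dec 0 x) as [Hx|Hx].
    - exists (x, y). split; [reflexivity | left; exact Hx].
    - destruct (Rlt_dec x 0) as [Hx'|Hx'].
      + exists (- (x, y))%C. split; [ring | left; simpl; lra].
      + destruct (Rle_dec y 0) as [Hy|Hy].
        * exists (x, y). split; [reflexivity | right; simpl; lra].
        * exists (- (x, y))%C. split; [ring | right; simpl; lra]. }
  assert (Hq : (Csqrt (r * r) * Csqrt (r * r) = r * r)%C)
    by exact (proj1 (epsilon_spec (inhabits (RtoC 0)) _ Hex)).
  set (q := Csqrt (r * r)) in *.
  assert (H : ((q - r) * (q + r) = 0)%C).
  { transitivity (q * q - r * r)%C; [ring|]. rewrite Hq. ring. }
  apply (f_equal Cmod) in H. rewrite Cmod_mult, Cmod_0 in H.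
  apply Rmult_integral in H. destruct H as [H|H]; apply Cmod_eq_0 in H.
  - left. replace q with (q - r + r)%C by ring. rewrite H; ring.
  - right. replace q with (q + r - r)%C by ring. rewrite H; ring.
Qed.

Lemma Ccos_opp (z : C) : Ccos (- z) = Ccos z.
Proof.
  unfold Ccos, Copp; simpl. rewrite cos_neg, sin_neg, cosh_opp, sinh_opp. f_equal; ring.
Qed.

(** Evenness of the cosine absorbs the sign chosen by the branch. So [Dt] at [r * r] does not jump
    with the root, which matters because [dQe] differentiates it at [rho_n], possibly at 0 on the
    edge of the branch. *)
Lemma Ccos_Csqrt_sqr (r w : C) : Ccos (Csqrt (r * r) * w) = Ccos (r * w).
Proof.
  destruct (Csqrt_sqr r) as [-> | ->]; [reflexivity|].
  replace (- r * w)%C with (- (r * w))%C by ring. apply Ccos_opp.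
Qed.

Lemma Ccos_mul_real (z : C) (x t : R) :
  (Ccos (z * CR t) * Ccos (CR x * CR t)
   = / 2 * (Ccos ((z - CR x) * CR t) + Ccos ((z + CR x) * CR t)))%C.
Proof.
  rewrite !Ccos_scal_R. destruct z as [a b].
  unfold Cmult, Cplus, Cminus, Copp, Cinv, CR, RtoC; simpl.
  rewrite Rmult_0_l, cosh_0, sinh_0.
  replace ((a + - x) * t) with (a * t - x * t) by ring.
  replace ((a + x) * t) with (a * t + x * t) by ring.
  replace ((b + - 0) * t) with (b * t) by ring.
  replace ((b + 0) * t) with (b * t) by ring.
  rewrite cos_minus, cos_plus, sin_minus, sin_plus. f_equal; field.
Qed.

Lemma RInt_half_sum (f g : R -> R) (a b : R) :
  ex_RInt f a b -> ex_RInt g a b ->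
  RInt (fun t => / 2 * (f t + g t)) a b = / 2 * (RInt f a b + RInt g a b).
Proof.
  intros Hf Hg.
  transitivity (/ 2 * RInt (fun t => f t + g t) a b).
  - apply (RInt_scal (V := R_CompleteNormedModule) (fun t => f t + g t)).
    exact (ex_RInt_plus (V := R_NormedModule) f g a b Hf Hg).
  - f_equal. exact (RInt_plus (V := R_CompleteNormedModule) f g a b Hf Hg).
Qed.

Lemma Dt_Kc (r : C) (i : nat) :
  Dt PI (r * r) (CR (INR i) * CR (INR i)) = Kc r i.
Proof.
  destruct (Cint_ok_cos (r - CR (INR i))) as [A1 A2].
  destruct (Cint_ok_cos (r + CR (INR i))) as [B1 B2].
  assert (H1 := RInt_half_sum _ _ _ _ A1 B1). assert (H2 := RInt_half_sum _ _ _ _ A2 B2).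
  assert (E : forall z : C, (/ 2 * z)%C = (/ 2 * fst z, / 2 * snd z)).
  { intros z. rewrite <- RtoC_inv by lra. unfold Cmult, RtoC; simpl. f_equal; ring. }
  unfold Kc, Cdiv. rewrite (Cmult_comm (_ + _)), E.
  transitivity (RInt (fun t => / 2 * (fst (Ccos ((r - CR (INR i)) * CR t))
                                      + fst (Ccos ((r + CR (INR i)) * CR t)))) 0 PI,
                RInt (fun t => / 2 * (snd (Ccos ((r - CR (INR i)) * CR t))
                                      + snd (Ccos ((r + CR (INR i)) * CR t)))) 0 PI);
    [|rewrite H1, H2; reflexivity].
  unfold Dt, CRInt.
  f_equal; apply RInt_ext; intros t _; rewrite !Ccos_Csqrt_sqr, Ccos_mul_real, E; reflexivity.
Qed.

Lemma CR_nat_sub (m i : nat) :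
  (CR (INR m) - CR (INR i))%C = CR (IZR (Z.of_nat m - Z.of_nat i)).
Proof. unfold CR. rewrite <- RtoC_minus, minus_IZR, !INR_IZR_INZ. reflexivity. Qed.

Lemma CR_nat_add (m i : nat) :
  (CR (INR m) + CR (INR i))%C = CR (IZR (Z.of_nat m + Z.of_nat i)).
Proof. unfold CR. rewrite <- RtoC_plus, plus_IZR, !INR_IZR_INZ. reflexivity. Qed.

Lemma Kc_orthogonal (m i : nat) : m <> i -> Kc (CR (INR m)) i = RtoC 0.
Proof.
  intros H. unfold Kc. rewrite CR_nat_sub, CR_nat_add, !Sint_int by lia. field.
Qed.

Lemma Kc_diag_0 : Kc (CR (INR 0)) 0 = CR PI.
Proof.
  unfold Kc. rewrite CR_nat_sub, CR_nat_add. change (CR (IZR (Z.of_nat 0 - Z.of_nat 0))) with (RtoC 0).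
  change (CR (IZR (Z.of_nat 0 + Z.of_nat 0))) with (RtoC 0). rewrite Sint_0. field.
Qed.

Lemma Kc_diag (m : nat) : (0 < m)%nat -> Kc (CR (INR m)) m = CR (PI / 2).
Proof.
  intros H. unfold Kc. rewrite CR_nat_sub, CR_nat_add, (Sint_int (_ + _)), Z.sub_diag by lia.
  change (CR (IZR 0)) with (RtoC 0). rewrite Sint_0.
  unfold CR. rewrite RtoC_div by lra. field.
Qed.

Lemma Cmod_half (z : C) : Cmod (z / 2) = Cmod z / 2.
Proof.
  rewrite Cmod_div, Cmod_R, Rabs_pos_eq; [reflexivity | lra |].
  intros E; apply (f_equal fst) in E; simpl in E; lra.
Qed.

Lemma Kc_int_bound (m i : nat) : Cmod (Kc (CR (INR m)) i) <= PI.
Proof.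
  assert (HPI := PI_RGT_0).
  assert (H : forall d, Cmod (Sint (CR (IZR d))) <= PI).
  { intros d. destruct (Z.eq_dec d 0) as [->|Hd].
    - change (CR (IZR 0)) with (RtoC 0). rewrite Sint_0. unfold CR. rewrite Cmod_R, Rabs_pos_eq; lra.
    - rewrite Sint_int, Cmod_0 by exact Hd. lra. }
  unfold Kc. rewrite CR_nat_sub, CR_nat_add, Cmod_half.
  assert (H1 := H (Z.of_nat m - Z.of_nat i)%Z). assert (H2 := H (Z.of_nat m + Z.of_nat i)%Z).
  assert (H3 := Cmod_triangle (Sint (CR (IZR (Z.of_nat m - Z.of_nat i)))) (Sint (CR (IZR (Z.of_nat m + Z.of_nat i))))).
  lra.
Qed.

(** Shifting by the real number [i] preserves imaginary parts, so the strip estimate for [Sint]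
    gives a constant independent of [i]. *)
Lemma Kc_lipschitz (h : R) :
  exists L, 0 < L /\ forall r r' i, Rabs (snd r) <= h -> Rabs (snd r') <= h ->
    Cmod (Kc r i - Kc r' i) <= L * Cmod (r - r').
Proof.
  assert (HPI := PI_RGT_0). assert (He := exp_pos (2 * PI * h)).
  exists (2 * (PI * (PI * exp (2 * PI * h)))). split.
  { repeat (assumption || lra || apply Rmult_lt_0_compat). }
  intros r r' i Hr Hr'. unfold Kc. set (c := CR (INR i)).
  replace ((Sint (r - c) + Sint (r + c)) / 2 - (Sint (r' - c) + Sint (r' + c)) / 2)%C
    with (((Sint (r - c) - Sint (r' - c)) + (Sint (r + c) - Sint (r' + c))) / 2)%C by field.
  rewrite Cmod_half.
  assert (H1 := Sint_lipschitz h (r - c) (r' - c)). assert (H2 := Sint_lipschitz h (r + c) (r' + c)).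
  replace (r - c - (r' - c))%C with (r - r')%C in H1 by ring.
  replace (r + c - (r' + c))%C with (r - r')%C in H2 by ring.
  unfold c in H1, H2; simpl in H1, H2. fold c in H1, H2.
  rewrite Ropp_0, !Rplus_0_r in H1. rewrite !Rplus_0_r in H2.
  specialize (H1 Hr Hr'). specialize (H2 Hr Hr').
  assert (H3 := Cmod_triangle (Sint (r - c) - Sint (r' - c)) (Sint (r + c) - Sint (r' + c))).
  lra.
Qed.

Lemma Kc_decay :
  exists A, 0 < A /\ forall m i w, Cmod w <= / 2 ->
    Cmod (Kc (CR (INR m) + w) i - Kc (CR (INR m)) i)
    <= A * (Cmod w * / (1 + Rabs (INR m - INR i))).
Proof.
  destruct Sint_decay as [A [HA H]]. exists A. split; [exact HA|]. intros m i w Hw.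
  unfold Kc. set (c := CR (INR i)). set (M := CR (INR m)).
  replace ((Sint (M + w - c) + Sint (M + w + c)) / 2 - (Sint (M - c) + Sint (M + c)) / 2)%C
    with (((Sint (M - c + w) - Sint (M - c)) + (Sint (M + c + w) - Sint (M + c))) / 2)%C.
  2: { replace (M + w - c)%C with (M - c + w)%C by ring.
       replace (M + w + c)%C with (M + c + w)%C by ring. field. }
  rewrite Cmod_half. unfold M, c. rewrite CR_nat_sub, CR_nat_add.
  assert (H1 := H (Z.of_nat m - Z.of_nat i)%Z w Hw). assert (H2 := H (Z.of_nat m + Z.of_nat i)%Z w Hw).
  assert (H3 := Cmod_triangle
    (Sint (CR (IZR (Z.of_nat m - Z.of_nat i)) + w) - Sint (CR (IZR (Z.of_nat m - Z.of_nat i))))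
    (Sint (CR (IZR (Z.of_nat m + Z.of_nat i)) + w) - Sint (CR (IZR (Z.of_nat m + Z.of_nat i))))).
  rewrite minus_IZR, <- !INR_IZR_INZ in H1. rewrite plus_IZR, <- !INR_IZR_INZ in H2.
  rewrite minus_IZR, plus_IZR, <- !INR_IZR_INZ in *.
  (* The summand at [m + i] decays at least as fast, since [|m - i| <= m + i]. *)
  assert (H4 : A * (Cmod w * / (1 + Rabs (INR m + INR i))) <= A * (Cmod w * / (1 + Rabs (INR m - INR i)))).
  { apply Rmult_le_compat_l; [lra|]. apply Rmult_le_compat_l; [apply Cmod_ge_0|].
    assert (Hm := pos_INR m). assert (Hi := pos_INR i). assert (Hp := Rabs_pos (INR m - INR i)).
    apply Rinv_le_contravar; [lra|]. apply Rplus_le_compat_l.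
    rewrite (Rabs_pos_eq (INR m + INR i)) by lra. apply Rabs_le; lra. }
  lra.
Qed.

(** * Complex derivatives, and that of the kernel at integers *)

Lemma is_derive_of_quadratic_remainder (f : C -> C) (z l : C) (A : R) :
  (forall h, Cmod h <= / 2 -> Cmod (f (z + h) - f z - h * l) <= A * Cmod h ^ 2)%C ->
  @is_derive C_AbsRing C_NormedModule f z l.
Proof.
  intros H. split; [apply is_linear_scal_l|].
  intros x Hx eps.
  apply (is_filter_lim_locally_unique (V := AbsRing_NormedModule C_AbsRing)) in Hx. subst x.
  (* The sign of [A] is not fixed, hence [Rabs A]; adding 1 keeps the denominator positive. The cap
     1/2 is the range of the remainder bound. *)
  assert (Hd : 0 < Rmin (/ 2) (eps / (Rabs A + 1))).
  { apply Rmin_pos; [lra|]. apply Rdiv_lt_0_compat; [apply cond_pos|].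
    assert (H0 := Rabs_pos A); lra. }
  exists (mkposreal _ Hd). intros y Hy.
  change (Cmod (y - z) < Rmin (/ 2) (eps / (Rabs A + 1))) in Hy.
  change (Cmod (f y - f z - (y - z) * l) <= eps * Cmod (y - z)).
  assert (H0 := Rabs_pos A).
  assert (Hy1 := Rlt_le_trans _ _ _ Hy (Rmin_l _ _)).
  assert (Hy2 := Rlt_le_trans _ _ _ Hy (Rmin_r _ _)).
  specialize (H (y - z)%C (Rlt_le _ _ Hy1)).
  assert (E : forall a b : C, (a + (b - a) = b)%C) by (intros; ring). rewrite E in H.
  eapply Rle_trans; [exact H|].
  assert (H1 := Cmod_ge_0 (y - z)). assert (H2 := Rle_abs A).
  assert (H3 : Cmod (y - z) * (Rabs A + 1) <= eps).
  { apply Rlt_le. apply Rmult_lt_reg_r with (/ (Rabs A + 1)); [apply Rinv_0_lt_compat; lra|].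
    rewrite Rmult_assoc, Rinv_r by lra. rewrite Rmult_1_r. exact Hy2. }
  simpl. rewrite Rmult_1_r, <- Rmult_assoc. apply Rmult_le_compat_r; [exact H1|]. nra.
Qed.

(** [Cderiv] is chosen by [epsilon], so computing it takes uniqueness of the derivative. Two limits,
    each accurate to a quarter of [|l' - l|] at a common real increment, would give
    [|l' - l| <= |l' - l| / 2]. *)
Lemma Cderiv_unique (f : C -> C) (z l : C) :
  @is_derive C_AbsRing C_NormedModule f z l -> Cderiv f z = l.
Proof.
  intros Hl.
  assert (Hl' : @is_derive C_AbsRing C_NormedModule f z (Cderiv f z)).
  { apply (epsilon_spec (inhabits (RtoC 0))
      (fun d => @is_derive C_AbsRing C_NormedModule f z d)). exists l; exact Hl. }
  set (l' := Cderiv f z) in *. clearbody l'.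
  destruct (Ceq_dec l' l) as [E|Hne]; [exact E|exfalso].
  assert (Hp : 0 < Cmod (l' - l)).
  { apply Cmod_gt_0. intros E. apply Hne. replace l' with (l' - l + l)%C by ring. rewrite E; ring. }
  assert (He : 0 < Cmod (l' - l) / 4) by lra.
  assert (Hz : is_filter_lim (@locally (AbsRing_UniformSpace C_AbsRing) z) z) by (intros P HP; exact HP).
  destruct (proj2 Hl z Hz (mkposreal _ He)) as [d1 H1].
  destruct (proj2 Hl' z Hz (mkposreal _ He)) as [d2 H2].
  set (d := Rmin d1 d2 / 2).
  assert (Hm : 0 < Rmin d1 d2) by (apply Rmin_pos; apply cond_pos).
  assert (Hd : 0 < d) by (unfold d; lra).
  assert (Hr : Rmin d1 d2 <= d1 /\ Rmin d1 d2 <= d2) by (split; [apply Rmin_l | apply Rmin_r]).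
  assert (Em : Cmod (z + CR d - z) = d).
  { replace (z + CR d - z)%C with (CR d) by ring. unfold CR. rewrite Cmod_R. apply Rabs_pos_eq; lra. }
  specialize (H1 (z + CR d)%C). specialize (H2 (z + CR d)%C).
  assert (B1 : Cmod (f (z + CR d)%C - f z - (z + CR d - z) * l) <= Cmod (l' - l) / 4 * Cmod (z + CR d - z)).
  { apply H1. change (Cmod (z + CR d - z) < d1). rewrite Em. unfold d; lra. }
  assert (B2 : Cmod (f (z + CR d)%C - f z - (z + CR d - z) * l') <= Cmod (l' - l) / 4 * Cmod (z + CR d - z)).
  { apply H2. change (Cmod (z + CR d - z) < d2). rewrite Em. unfold d; lra. }
  assert (B3 := Cmod_triangle (f (z + CR d)%C - f z - (z + CR d - z) * l)
                  (- (f (z + CR d)%C - f z - (z + CR d - z) * l'))).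
  rewrite Cmod_opp in B3.
  replace (f (z + CR d)%C - f z - (z + CR d - z) * l + - (f (z + CR d)%C - f z - (z + CR d - z) * l'))%C
    with ((z + CR d - z) * (l' - l))%C in B3 by ring.
  rewrite Cmod_mult in B3. rewrite Em in *. nra.
Qed.

(** A derivative enters [Hmat] only when [rho_n] equals its model value, hence at an integer. One
    [k] serves every [al], because [dQe] differentiates the kernel together with its weight. *)
Lemma Kc_derivative (m i : nat) :
  exists k, Cmod k <= PI /\ forall al,
    @is_derive C_AbsRing C_NormedModule (fun r => al * Kc r i)%C (CR (INR m)) (al * k)%C.
Proof.
  destruct Sint_expansion as [A [HA H]].
  destruct (H (Z.of_nat m - Z.of_nat i)%Z) as [s1 [Hs1 H1]].
  destruct (H (Z.of_nat m + Z.of_nat i)%Z) as [s2 [Hs2 H2]].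
  exists ((s1 + s2) / 2)%C. split.
  { rewrite Cmod_half. assert (H3 := Cmod_triangle s1 s2). lra. }
  intros al. apply (is_derive_of_quadratic_remainder _ _ _ (Cmod al * A)). intros h Hh.
  specialize (H1 h Hh). specialize (H2 h Hh).
  rewrite <- CR_nat_sub in H1. rewrite <- CR_nat_add in H2.
  unfold Kc. set (c := CR (INR i)) in *. set (M := CR (INR m)) in *.
  replace (M + h - c)%C with (M - c + h)%C by ring.
  replace (M + h + c)%C with (M + c + h)%C by ring.
  replace (al * ((Sint (M - c + h) + Sint (M + c + h)) / 2) - al * ((Sint (M - c) + Sint (M + c)) / 2)
           - h * (al * ((s1 + s2) / 2)))%C
    with (al * (((Sint (M - c + h) - Sint (M - c) - h * s1) + (Sint (M + c + h) - Sint (M + c) - h * s2)) / 2))%C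
    by field.
  rewrite Cmod_mult, Cmod_half, Rmult_assoc. apply Rmult_le_compat_l; [apply Cmod_ge_0|].
  assert (H3 := Cmod_triangle (Sint (M - c + h) - Sint (M - c) - h * s1) (Sint (M + c + h) - Sint (M + c) - h * s2)).
  lra.
Qed.

(** * A sequence annihilated by all [rho_n] with [alpha_n <> 0] *)

Lemma inv_sqr_telescope (b : R) : 0 < b -> (/ (b + 1)) ^ 2 <= / b - / (b + 1).
Proof.
  intros Hb. replace (/ b - / (b + 1)) with (/ b * / (b + 1)) by (field; lra).
  simpl. rewrite Rmult_1_r. apply Rmult_le_compat_r.
  - left; apply Rinv_0_lt_compat; lra.
  - apply Rinv_le_contravar; lra.
Qed.

Lemma sum_inv_sqr_dist_le (i N : nat) :
  sum_n (fun m => (/ (1 + Rabs (INR m - INR i))) ^ 2) N <= 3.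
Proof.
  (* The running bound makes the induction work: telescoping gives at most 1 to the left of [i],
     then 1 at [i], then at most 1 to the right. *)
  assert (H : sum_n (fun m => (/ (1 + Rabs (INR m - INR i))) ^ 2) N
              <= if (N <? i)%nat then / (INR i - INR N) else 3 - / (1 + (INR N - INR i))).
  { induction N as [|N IH].
    - rewrite sum_O. destruct (Nat.ltb_spec 0 i) as [Hi|Hi].
      + apply lt_INR in Hi. simpl INR in *.
        replace (1 + Rabs (0 - INR i)) with (INR i + 1)
          by (rewrite Rabs_left by lra; ring).
        assert (H := inv_sqr_telescope (INR i) Hi).
        assert (H1 := Rinv_0_lt_compat (INR i + 1) ltac:(lra)).
        rewrite Rminus_0_r. lra.
      + replace i with 0%nat by lia. simpl INR.
        replace (0 - 0) with 0 by ring. rewrite Rabs_R0, Rplus_0_r, Rinv_1. lra.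
    - rewrite sum_Sn. change plus with Rplus.
      destruct (Nat.ltb_spec N i) as [Hi|Hi], (Nat.ltb_spec (S N) i) as [Hi'|Hi']; try lia.
      + apply lt_INR in Hi'. rewrite S_INR in *.
        replace (1 + Rabs (INR N + 1 - INR i)) with (INR i - (INR N + 1) + 1)
          by (rewrite Rabs_left by lra; ring).
        assert (H := inv_sqr_telescope (INR i - (INR N + 1)) ltac:(lra)).
        replace (INR i - (INR N + 1) + 1) with (INR i - INR N) in * by ring. lra.
      + replace i with (S N) in * by lia. rewrite S_INR in *.
        replace (INR N + 1 - (INR N + 1)) with 0 by ring.
        replace (INR N + 1 - INR N) with 1 in IH by ring.
        rewrite Rabs_R0, Rplus_0_r, Rinv_1 in *. lra.
      + apply le_INR in Hi. rewrite S_INR in *.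
        replace (1 + Rabs (INR N + 1 - INR i)) with (1 + (INR N - INR i) + 1)
          by (rewrite Rabs_pos_eq by lra; ring).
        assert (H := inv_sqr_telescope (1 + (INR N - INR i)) ltac:(lra)).
        replace (1 + (INR N + 1 - INR i)) with (1 + (INR N - INR i) + 1) by ring. lra. }
  eapply Rle_trans; [exact H|]. destruct (Nat.ltb_spec N i) as [Hi|Hi].
  - assert (H1 : INR (S N) <= INR i) by (apply le_INR; lia). rewrite S_INR in H1.
    apply Rle_trans with (/ 1); [|lra]. apply Rinv_le_contravar; lra.
  - apply le_INR in Hi. assert (0 < / (1 + (INR N - INR i))) by (apply Rinv_0_lt_compat; lra). lra.
Qed.

Lemma tail_sum_small (a : nat -> R) (eps : R) :
  (forall n, 0 <= a n) -> ex_series a -> 0 < eps ->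
  exists J, forall M, (J <= M)%nat -> forall N,
    sum_n (fun m => if (m <? M)%nat then 0 else a m) N <= eps.
Proof.
  intros Ha Hex He. assert (Hl := Series_correct a Hex). set (l := Series a) in Hl.
  assert (Hinc : forall n, sum_n a n <= sum_n a (S n)).
  { intros n; rewrite sum_Sn. change plus with Rplus. specialize (Ha (S n)); lra. }
  assert (Hup : forall n, sum_n a n <= l) by (apply is_lim_seq_incr_compare; [exact Hl | exact Hinc]).
  assert (Hl' := proj2 (is_lim_seq_spec (sum_n a) l) Hl (mkposreal _ He)).
  (* The successor makes the threshold positive, so that the tail is a total minus a partial sum. *)
  destruct Hl' as [J HJ]. exists (S J). intros [|M] HM N; [lia|].
  assert (HM' : l - eps < sum_n a M).
  { specialize (HJ M ltac:(lia)). simpl in HJ. apply Rabs_def2 in HJ. lra. }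
  set (b := fun m => if (m <? S M)%nat then 0 else a m).
  assert (Hb : forall k, sum_n b (M + k) = sum_n a (M + k) - sum_n a M).
  { induction k as [|k IH].
    - rewrite Nat.add_0_r, Rminus_diag.
      rewrite (sum_n_ext_loc b (fun _ => 0 * 0)).
      + rewrite sum_n_scal_R. apply Rmult_0_l.
      + intros m Hm. unfold b. destruct (Nat.ltb_spec m (S M)); [in_R; ring | lia].
    - rewrite Nat.add_succ_r, !sum_Sn, IH. unfold b at 1.
      destruct (Nat.ltb_spec (S (M + k)) (S M)); [lia|]. in_R. ring. }
  assert (Hmono : forall k, sum_n b N <= sum_n b (N + k)).
  { induction k as [|k IH]; [rewrite Nat.add_0_r; lra|].
    rewrite Nat.add_succ_r, sum_Sn. change plus with Rplus.
    assert (0 <= b (S (N + k))) by (unfold b; destruct (Nat.ltb _ _); [lra | apply Ha]). lra. }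
  specialize (Hmono M). rewrite Nat.add_comm, Hb in Hmono. specialize (Hup (M + N)%nat).
  change (sum_n b N <= eps). lra.
Qed.

Lemma Cseries_single (u : nat -> C) (m : nat) :
  (forall i, i <> m -> u i = RtoC 0) -> Cseries u (u m).
Proof.
  intros Hu.
  assert (Hs : forall k, sum_n u (m + k) = u m).
  { induction k as [|k IH].
    - rewrite Nat.add_0_r. destruct m as [|m]; [apply sum_O|].
      rewrite sum_Sn, sum_n_0_C by (intros; apply Hu; lia).
      change (0 + u (S m) = u (S m))%C. ring.
    - rewrite Nat.add_succ_r, sum_Sn, IH, (Hu (S (m + k))) by lia.
      change (u m + 0 = u m)%C. ring. }
  apply (filterlim_ext_loc (fun _ => u m)).
  - exists m. intros n Hn. rewrite <- (Hs (n - m)%nat). f_equal. lia.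
  - apply filterlim_const.
Qed.

Lemma Cseries_sum (u : nat -> nat -> C) (l : nat -> C) (n : nat) :
  (forall s, Cseries (u s) (l s)) ->
  Cseries (fun i => sum_n (fun s => u s i) n) (sum_n l n).
Proof.
  intros H. induction n as [|n IH].
  - rewrite sum_O. apply (is_series_ext (V := C_NormedModule) (u 0%nat)); [|apply H].
    intros i; rewrite sum_O; reflexivity.
  - rewrite sum_Sn.
    apply (is_series_ext (V := C_NormedModule) (fun i => sum_n (fun s => u s i) n + u (S n) i)%C).
    + intros i; rewrite sum_Sn; reflexivity.
    + apply Cseries_plus; [exact IH | apply H].
Qed.

Lemma Kc_bounded (r : C) : exists B, forall i, Cmod (Kc r i) <= B.
Proof.
  destruct (Kc_lipschitz (Rabs (snd r))) as [L [HL H]].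
  exists (L * Cmod (r - CR (INR 0)) + PI). intros i.
  replace (Kc r i) with ((Kc r i - Kc (CR (INR 0)) i) + Kc (CR (INR 0)) i)%C by ring.
  eapply Rle_trans; [apply Cmod_triangle|].
  apply Rplus_le_compat; [|apply Kc_int_bound].
  apply H; [lra|]. simpl. rewrite Rabs_R0. apply Rabs_pos.
Qed.

Lemma Kc_diag_sum (g : nat -> C) (m : nat) :
  Cseries (fun i => Kc (CR (INR m)) i * g i)%C (Kc (CR (INR m)) m * g m)%C.
Proof.
  apply (Cseries_single (fun i => Kc (CR (INR m)) i * g i)%C).
  intros i Hi. rewrite Kc_orthogonal by auto. ring.
Qed.

(* AM-GM [A k w <= w^2 / 12 + 3 A^2 k^2] against [sum w^2 <= 3]; the constant
   12 makes the column sums at most 1/2. *)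
Lemma perturbation_columns_small (kap : nat -> C) :
  l2 kap ->
  exists J, forall M, (J <= M)%nat -> forall i N,
    sum_n (fun m => Cmod (if (m <? M)%nat then RtoC 0 else
       - CR (2 / PI) * (Kc (CR (INR m) + kap m) i - Kc (CR (INR m)) i))%C) N <= / 2.
Proof.
  intros Hk. destruct Kc_decay as [A [HA Hdec]].
  assert (HPI := PI_RGT_0). assert (HPI2 : 2 <= PI).
  { assert (H := PI2_1). unfold PI2 in H. lra. }
  set (A1 := A + 1). assert (HA1 : 1 <= A1) by (unfold A1; lra).
  assert (Hden : 12 <= 12 * A1 ^ 2) by nra.
  set (eps := / (12 * A1 ^ 2)).
  assert (Heps : 0 < eps) by (apply Rinv_0_lt_compat; lra).
  assert (Heps' : eps <= / 12) by (apply Rinv_le_contravar; lra).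
  destruct (tail_sum_small (fun j => Cmod (kap j) ^ 2) eps) as [J HJ];
    [intros; apply pow2_ge_0 | exact Hk | exact Heps |].
  exists J. intros M HM i N. specialize (HJ M HM).
  set (t := fun m => if (m <? M)%nat then 0 else Cmod (kap m) ^ 2) in HJ.
  assert (Ht : forall m, 0 <= t m) by (intros m; unfold t; destruct (Nat.ltb _ _); [lra | apply pow2_ge_0]).
  set (w := fun m => / (1 + Rabs (INR m - INR i))).
  apply Rle_trans with (sum_n (fun m => / 12 * (w m) ^ 2 + 3 * A1 ^ 2 * t m) N).
  - apply sum_n_le_loc. intros m _.
    (* [eps <= / 12] also forces [|kap m| <= 1/2], the range of [Kc_decay]. *)
    assert (Htm : t m <= / 12).
    { eapply Rle_trans; [apply (term_le_sum_n t m m Ht); lia|]. exact (Rle_trans _ _ _ (HJ m) Heps'). }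
    unfold t in *. destruct (Nat.ltb_spec m M) as [Hm|Hm].
    + rewrite Cmod_0. assert (H := pow2_ge_0 (w m)). lra.
    + assert (Hhalf : Cmod (kap m) <= / 2) by (assert (H := Cmod_ge_0 (kap m)); nra).
      specialize (Hdec m i (kap m) Hhalf).
      rewrite Cmod_mult, Cmod_opp. unfold CR at 1. rewrite Cmod_R.
      assert (Hq : 0 < 2 / PI <= 1).
      { split; [apply Rdiv_lt_0_compat; lra|].
        apply Rmult_le_reg_r with PI; [lra|]. unfold Rdiv. rewrite Rmult_assoc, Rinv_l; lra. }
      rewrite Rabs_pos_eq by lra. fold (w m) in Hdec.
      assert (Hw : 0 < w m).
      { apply Rinv_0_lt_compat. assert (H := Rabs_pos (INR m - INR i)). lra. }
      set (k := Cmod (kap m)) in *. assert (Hk0 : 0 <= k) by apply Cmod_ge_0.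
      set (D := Cmod (Kc (CR (INR m) + kap m) i - Kc (CR (INR m)) i)) in *.
      assert (HD : 0 <= D) by apply Cmod_ge_0.
      assert (Hkw : 0 <= k * w m) by nra.
      assert (H1 : 2 / PI * D <= A1 * (k * w m)) by (unfold A1; nra).
      (* Three times this square, expanded, is the AM-GM inequality. *)
      assert (H2 := pow2_ge_0 (w m / 6 - A1 * k)). nra.
  - rewrite sum_n_plus_R, !sum_n_scal_R.
    assert (H1 := sum_inv_sqr_dist_le i N).
    change (sum_n (fun m => w m ^ 2) N <= 3) in H1.
    assert (H2 : 3 * A1 ^ 2 * sum_n t N <= 3 * A1 ^ 2 * eps)
      by (apply Rmult_le_compat_l; [nra | apply HJ]).
    (* [eps] is chosen to make this part 1/4; the other is at most [3 / 12]. *)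
    replace (3 * A1 ^ 2 * eps) with (/ 4) in H2 by (unfold eps; field; lra). lra.
Qed.

Definition unit_seq (s i : nat) : C := if Nat.eq_dec i s then RtoC 1 else RtoC 0.

Lemma l1_le_unit_seq (s : nat) : l1_le (unit_seq s) 1.
Proof.
  assert (H : forall N, sum_n (fun i => Cmod (unit_seq s i)) N = if (N <? s)%nat then 0 else 1).
  { induction N as [|N IH].
    - rewrite sum_O. unfold unit_seq. destruct (Nat.eq_dec 0 s), (Nat.ltb_spec 0 s); try lia;
        [apply Cmod_1 | apply Cmod_0].
    - rewrite sum_Sn, IH. unfold unit_seq.
      destruct (Nat.eq_dec (S N) s), (Nat.ltb_spec N s), (Nat.ltb_spec (S N) s); try lia;
        rewrite ?Cmod_1, ?Cmod_0; in_R; ring. }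
  intros N. rewrite H. destruct (N <? s)%nat; lra.
Qed.

Lemma sum_n_unit_seq (x : nat -> C) (n i : nat) :
  (i <= n)%nat -> sum_n (fun s => x s * unit_seq s i)%C n = x i.
Proof.
  intros Hi. assert (H : forall N, sum_n (fun s => x s * unit_seq s i)%C N
                          = if (N <? i)%nat then RtoC 0 else x i).
  { induction N as [|N IH].
    - rewrite sum_O. unfold unit_seq. destruct (Nat.eq_dec i 0) as [E|], (Nat.ltb_spec 0 i); try lia;
        try rewrite E; in_C; ring.
    - rewrite sum_Sn, IH. unfold unit_seq.
      destruct (Nat.eq_dec i (S N)) as [E|], (Nat.ltb_spec N i), (Nat.ltb_spec (S N) i); try lia;
        try rewrite E; match goal with |- @eq _ (plus ?a ?b) ?c => change (Cplus a b = c) end; ring. }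
  rewrite H. destruct (Nat.ltb_spec n i); [lia | reflexivity].
Qed.

Lemma annihilating_sequence (p : nat) (lam alpha : nat -> C) :
  in_Sp p lam alpha -> AB_ge lam alpha (S p) ->
  exists g G, l1_le g G /\ (exists i, g i <> RtoC 0) /\
    forall j, alpha j <> CR 0 -> Cseries (fun i => Kc (rho_of lam j) i * g i)%C (RtoC 0).
Proof.
  intros [vk [ka [Hvk [_ [Hrho _]]]]] [N0 HN0].
  assert (HPI := PI_RGT_0).
  set (kap := fun m => vk (m + p)%nat).
  assert (Hkap : l2 kap).
  { unfold l2, kap. apply (ex_series_ext (fun j => Cmod (vk (p + j)%nat) ^ 2)).
    - intros n; rewrite Nat.add_comm; reflexivity.
    - exact (proj1 (ex_series_incr_n (V := R_NormedModule) (fun j => Cmod (vk j) ^ 2) p) Hvk). }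
  destruct (perturbation_columns_small kap Hkap) as [J HJ].
  (* [J] makes the columns of [B] small; [N0] makes the truncation at [M + p] already witness
     [A + B >= p + 1]. *)
  set (M := (J + N0 + 1)%nat). specialize (HJ M ltac:(unfold M; lia)).
  (* Divided by [K(m, m) = PI / 2], the equation [G(m + kap m) = 0] reads [g m = (B g) m]. The zero
     rows below [M] leave those coordinates to the right-hand side. *)
  set (B := fun m i => if (m <? M)%nat then RtoC 0 else
       (- CR (2 / PI) * (Kc (CR (INR m) + kap m) i - Kc (CR (INR m)) i))%C) in *.
  set (sol := fun s => constructive_indefinite_description _
     (l1_contraction_solution B (unit_seq s) 1 HJ (l1_le_unit_seq s))).
  set (gs := fun s => proj1_sig (sol s)).
  set (sol' := fun s => constructive_indefinite_description _ (proj2_sig (sol s))).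
  set (Gs := fun s => proj1_sig (sol' s)).
  assert (Hgs1 : forall s, l1_le (gs s) (Gs s)) by (intros s; exact (proj1 (proj2_sig (sol' s)))).
  assert (Hgs2 : forall s m, Cseries (fun i => B m i * gs s i)%C (gs s m - unit_seq s m)%C)
    by (intros s; exact (proj2 (proj2_sig (sol' s)))).
  clearbody gs Gs. clear sol' sol.
  assert (Hhead : forall s i, (i < M)%nat -> gs s i = unit_seq s i).
  { intros s i Hi.
    assert (H : Cseries (fun i' => B i i' * gs s i')%C (B i 0%nat * gs s 0%nat)%C).
    { apply (Cseries_single (fun i' => B i i' * gs s i')%C). intros i' _.
      unfold B. destruct (Nat.ltb_spec i M); [ring | lia]. }
    assert (E := Cseries_unique _ _ _ (Hgs2 s i) H).
    unfold B in E. destruct (Nat.ltb_spec i M); [|lia].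
    replace (gs s i) with (gs s i - unit_seq s i + unit_seq s i)%C by ring. rewrite E. ring. }
  assert (Htail : forall s m, (s < M)%nat -> (M <= m)%nat ->
    Cseries (fun i => Kc (CR (INR m) + kap m)%C i * gs s i)%C (RtoC 0)).
  { intros s m Hs Hm.
    apply (is_series_ext (V := C_NormedModule)
      (fun i => Kc (CR (INR m)) i * gs s i + - CR (PI / 2) * (B m i * gs s i))%C).
    - intros i. unfold B. destruct (Nat.ltb_spec m M); [lia|].
      assert (E : (CR (PI / 2) * CR (2 / PI) = 1)%C).
      { unfold CR. rewrite <- RtoC_mult. f_equal. field. lra. }
      transitivity (Kc (CR (INR m)) i * gs s i + (CR (PI / 2) * CR (2 / PI))
        * ((Kc (CR (INR m) + kap m)%C i - Kc (CR (INR m)) i) * gs s i))%C; [in_C; ring|].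
      rewrite E. in_C; ring.
    - assert (E : unit_seq s m = RtoC 0)
        by (unfold unit_seq; destruct (Nat.eq_dec m s); [lia | reflexivity]).
      replace (RtoC 0) with (Kc (CR (INR m)) m * gs s m + - CR (PI / 2) * (gs s m - unit_seq s m))%C.
      + apply Cseries_plus; [apply Kc_diag_sum | apply Cseries_scal, Hgs2].
      + rewrite E, Kc_diag by lia. ring. }
  (* Every combination of the [gs s] with [s < M] already solves the equations with index at least
     [M + p]; the distinct values among earlier indices remain. *)
  set (reps := new_values lam alpha (M + p)).
  set (n := length reps).
  (* [n <= (M + p) - (p + 1) = M - 1], so all [n + 1] unknowns multiply some [gs s] with [s < M]. *)
  assert (Hn : (n < M)%nat).
  { assert (H1 := length_new_values lam alpha (M + p)).
    assert (H2 := AB_trunc_mono lam alpha N0 (M + p) ltac:(unfold M; lia)).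
    unfold n, reps. lia. }
  assert (Hconv : forall r s, Cseries (fun i => Kc r i * gs s i)%C (Csum (fun i => Kc r i * gs s i)%C)).
  { intros r s. destruct (Kc_bounded r) as [Bd HBd].
    apply (Csum_correct _ (Bd * Gs s)). apply l1_le_mult; auto. }
  set (row := fun k s => Csum (fun i => Kc (rho_of lam k) i * gs s i)%C).
  destruct (underdetermined_system n (map row reps)) as [x [[s0 [Hs0 Hx0]] Hx]].
  { apply length_map. }
  exists (fun i => sum_n (fun s => x s * gs s i)%C n), (sum_n (fun s => Cmod (x s) * Gs s) n).
  split; [|split].
  - apply (l1_le_sum (fun s i => x s * gs s i)%C). intros s.
    apply (l1_le_mult (fun _ => x s)); [intros; lra | auto].
  - exists s0. rewrite (sum_n_ext _ (fun s => x s * unit_seq s s0)%C).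
    + rewrite sum_n_unit_seq by exact Hs0. exact Hx0.
    + intros s. rewrite Hhead by lia. reflexivity.
  - intros j Ha.
    (* The sums are prescribed for [s <= n] only, since [Htail] holds for [s < M]. *)
    assert (Hlin : forall l, (forall s, (s <= n)%nat -> Cseries (fun i => Kc (rho_of lam j) i * gs s i)%C (l s)) ->
      Cseries (fun i => Kc (rho_of lam j) i * sum_n (fun s => x s * gs s i)%C n)%C
              (sum_n (fun s => x s * l s)%C n)).
    { intros l Hl.
      apply (is_series_ext (V := C_NormedModule)
        (fun i => sum_n (fun s => x s * (Kc (rho_of lam j) i * gs s i))%C n)).
      - intros i. rewrite <- sum_n_scal_C. apply sum_n_ext. intros s. in_C; ring.
      - rewrite (sum_n_ext_loc (fun s => x s * l s)%C
          (fun s => x s * Csum (fun i => Kc (rho_of lam j) i * gs s i))%C).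
        + apply (Cseries_sum (fun s i => x s * (Kc (rho_of lam j) i * gs s i))%C).
          intros s. apply Cseries_scal, Hconv.
        + intros s Hs. f_equal. exact (Cseries_unique _ _ _ (Hl s Hs) (Hconv _ s)). }
    destruct (Nat.lt_ge_cases j (M + p)) as [Hj|Hj].
    + destruct (new_values_cover lam alpha (M + p) j Hj Ha) as [k [Hk Hlk]].
      assert (E : rho_of lam j = rho_of lam k) by (unfold rho_of; rewrite Hlk; reflexivity).
      assert (Hr := Hx _ (in_map row _ _ Hk)).
      rewrite <- Hr. rewrite (sum_n_ext _ (fun s => x s * row k s)%C) by (intros; in_C; ring).
      apply Hlin. intros s _. unfold row. rewrite <- E. apply Hconv.
    + rewrite <- (sum_n_0_C (fun s => x s * 0)%C n) by (intros; ring).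
      apply (Hlin (fun _ => RtoC 0)). intros s Hs.
      replace (rho_of lam j) with (CR (INR (j - p)) + kap (j - p)%nat)%C.
      * apply Htail; lia.
      * rewrite Hrho. unfold kap. rewrite minus_INR by lia. f_equal. f_equal. lia.
Qed.

(** * The kernel element *)

Lemma l2_bounded (u : nat -> C) : l2 u -> exists X, forall j, Cmod (u j) <= X.
Proof.
  intros H. set (a := fun j => Cmod (u j) ^ 2).
  assert (Ha : forall j, 0 <= a j) by (intros; apply pow2_ge_0).
  assert (Hl := Series_correct a H). exists (Series a + 1). intros j.
  assert (H1 : sum_n a j <= Series a).
  { apply (is_lim_seq_incr_compare (sum_n a)); [exact Hl|].
    intros n; rewrite sum_Sn. change plus with Rplus. specialize (Ha (S n)); lra. }
  assert (H2 : a j <= Series a) by (eapply Rle_trans; [apply (term_le_sum_n a j j Ha); lia | exact H1]).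
  unfold a in H2 at 1. assert (H3 := Cmod_ge_0 (u j)). nra.
Qed.

(** Truncated subtraction merges the two branches of [rho_model]. *)
Lemma rho_model_nat (p j : nat) : rho_model p j = CR (INR (j - p)).
Proof.
  unfold rho_model. destruct (Nat.leb_spec j p) as [H|H].
  - replace (j - p)%nat with 0%nat by lia. reflexivity.
  - rewrite minus_INR by lia. reflexivity.
Qed.

(** One [d] stands for the quotient or the derivative, so a single kernel vector fits both cases of
    [Hmat]; its bound, uniform in [n] and [i], keeps [a_n0] bounded. Uniformity holds because
    bounded deviations confine all [rho_n] to a horizontal strip. *)
Lemma quotient_or_derivative (p : nat) (lam alpha : nat -> C) :
  in_Sp p lam alpha ->
  exists Q, forall n i, exists d, Cmod d <= Q /\
    Kc (rho_of lam n) i = (Kc (rho_model p n) i + rho_hat p lam n * d)%C /\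
    (rho_hat p lam n = CR 0 -> forall al,
       @is_derive C_AbsRing C_NormedModule (fun r => al * Kc r i)%C (rho_of lam n) (al * d)%C).
Proof.
  intros [vk [_ [Hvk [_ [Hrho _]]]]].
  destruct (l2_bounded vk Hvk) as [X HX].
  destruct (Kc_lipschitz X) as [L [HL HLip]].
  assert (HPI := PI_RGT_0). exists (L + PI). intros n i.
  destruct (classic (rho_hat p lam n = CR 0)) as [E|E].
  - assert (En : rho_of lam n = rho_model p n).
    { unfold rho_hat in E. replace (rho_of lam n) with (rho_of lam n - rho_model p n + rho_model p n)%C by ring.
      rewrite E. unfold CR. ring. }
    rewrite En, rho_model_nat. destruct (Kc_derivative (n - p) i) as [d [Hd Hder]].
    exists d. split; [lra|]. split; [rewrite E; unfold CR; ring | intros _; exact Hder].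
  - set (rh := rho_hat p lam n) in *.
    exists ((Kc (rho_of lam n) i - Kc (rho_model p n) i) / rh)%C.
    split; [|split; [field; exact E | intros E'; contradiction]].
    rewrite Cmod_div by exact E.
    assert (H0 : 0 < Cmod rh) by (apply Cmod_gt_0; exact E).
    assert (HX0 : 0 <= X) by (eapply Rle_trans; [apply Cmod_ge_0 | apply (HX 0%nat)]).
    assert (H : Cmod (Kc (rho_of lam n) i - Kc (rho_model p n) i) <= L * Cmod rh).
    { apply HLip.
      - rewrite Hrho. simpl. rewrite Rplus_0_l.
        eapply Rle_trans; [apply Rabs_snd_le_Cmod | apply HX].
      - rewrite rho_model_nat. simpl. rewrite Rabs_R0. exact HX0. }
    apply Rle_trans with L; [|lra]. apply Rmult_le_reg_r with (Cmod rh); [exact H0|].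
    unfold Rdiv. rewrite Rmult_assoc, Rinv_l by lra. lra.
Qed.

(* The model sequence repeats the frequency 0 for the first [p + 1] indices, but
   only the first of them has a nonzero weight. *)
Lemma Cseries_model_index (p : nat) (v : nat -> C) (l : C) :
  Cseries v l ->
  Cseries (fun k => if (k =? 0)%nat then v 0%nat
                    else if (k <=? p)%nat then RtoC 0 else v (k - p)%nat) l.
Proof.
  intros H. set (u := fun k => if (k =? 0)%nat then v 0%nat
                    else if (k <=? p)%nat then RtoC 0 else v (k - p)%nat).
  assert (Hp : forall q, (q <= p)%nat -> sum_n u q = v 0%nat).
  { induction q as [|q IH]; intros Hq; [exact (sum_O u)|].
    rewrite sum_Sn, IH by lia. unfold u. simpl (S q =? 0)%nat. cbv iota.
    rewrite (proj2 (Nat.leb_le (S q) p)) by lia. change (v 0%nat + 0 = v 0%nat)%C. ring. }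
  assert (Hs : forall n, sum_n u (p + n) = sum_n v n).
  { induction n as [|n IH].
    - rewrite Nat.add_0_r, sum_O. apply Hp; lia.
    - rewrite Nat.add_succ_r, !sum_Sn, IH. f_equal. unfold u. simpl (S (p + n) =? 0)%nat. cbv iota.
      rewrite (proj2 (Nat.leb_gt (S (p + n)) p)) by lia. f_equal. lia. }
  unfold is_series. apply (filterlim_ext_loc (fun n => sum_n v (n - p))).
  - exists p. intros n Hn. rewrite <- Hs. f_equal. lia.
  - apply (filterlim_comp _ _ _ (fun n => (n - p)%nat) (sum_n v) _ eventually); [|exact H].
    intros P [N HN]. exists (N + p)%nat. intros n Hn. apply HN. lia.
Qed.

Theorem theorem5p1 (p : nat) (lam alpha : nat -> C) :
  in_Sp p lam alpha ->
  AB_ge lam alpha (S p) ->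
  ~ invertible_on_m (Hmat p lam alpha PI).
Proof.
  intros HS HAB Hinv. assert (HPI := PI_RGT_0).
  destruct (annihilating_sequence p lam alpha HS HAB) as [g [G [HG [[i0 Hi0] Hann]]]].
  destruct (quotient_or_derivative p lam alpha HS) as [Q HQ].
  set (dq := fun n i => proj1_sig (constructive_indefinite_description _ (HQ n i))).
  assert (Hdq1 : forall n i, Cmod (dq n i) <= Q)
    by (intros n i; exact (proj1 (proj2_sig (constructive_indefinite_description _ (HQ n i))))).
  assert (Hdq2 : forall n i, Kc (rho_of lam n) i = (Kc (rho_model p n) i + rho_hat p lam n * dq n i)%C)
    by (intros n i; exact (proj1 (proj2 (proj2_sig (constructive_indefinite_description _ (HQ n i)))))).
  assert (Hdq3 : forall n i, rho_hat p lam n = CR 0 -> forall al,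
       @is_derive C_AbsRing C_NormedModule (fun r => al * Kc r i)%C (rho_of lam n) (al * dq n i)%C)
    by (intros n i; exact (proj2 (proj2 (proj2_sig (constructive_indefinite_description _ (HQ n i)))))).
  clearbody dq. clear HQ.
  assert (HKb : forall n i, Cmod (Kc (rho_model p n) i) <= PI)
    by (intros; rewrite rho_model_nat; apply Kc_int_bound).
  set (a0 := fun n => Csum (fun i => dq n i * g i)%C).
  set (a1 := fun n => Csum (fun i => Kc (rho_model p n) i * g i)%C).
  assert (Hb0 : forall n, l1_le (fun i => dq n i * g i)%C (Q * G)) by (intros; apply l1_le_mult; auto).
  assert (Hb1 : forall n, l1_le (fun i => Kc (rho_model p n) i * g i)%C (PI * G)) by (intros; apply l1_le_mult; auto).
  assert (H0 : forall n, Cseries (fun i => dq n i * g i)%C (a0 n)) by (intros n; exact (Csum_correct _ _ (Hb0 n))).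
  assert (H1 : forall n, Cseries (fun i => Kc (rho_model p n) i * g i)%C (a1 n)) by (intros n; exact (Csum_correct _ _ (Hb1 n))).
  assert (Ha1 : forall n, a1 n = (Kc (CR (INR (n - p))) (n - p) * g (n - p)%nat)%C).
  { intros n. assert (H := H1 n). rewrite rho_model_nat in H.
    exact (Cseries_unique _ _ _ H (Kc_diag_sum g (n - p))). }
  (* The left side is the first entry of [T_k^(-1) a_k], namely [G(rho_k)]. *)
  assert (Hc0 : forall k, alpha k <> CR 0 -> (rho_hat p lam k * a0 k + a1 k = 0)%C).
  { intros k Hk. apply (Cseries_unique (fun i => Kc (rho_of lam k) i * g i)%C); [|exact (Hann k Hk)].
    apply (is_series_ext (V := C_NormedModule)
      (fun i => rho_hat p lam k * (dq k i * g i) + Kc (rho_model p k) i * g i)%C).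
    - intros i. rewrite (Hdq2 k i). in_C. ring.
    - apply Cseries_plus; [apply Cseries_scal, H0 | apply H1]. }
  (* Each nonzero model weight is the reciprocal of [K(m, m)], so the weighted [a1] returns the
     coefficients of [g]. *)
  assert (Hw : forall k, (alpha_model p k * a1 k)%C
     = if (k =? 0)%nat then g 0%nat else if (k <=? p)%nat then RtoC 0 else g (k - p)%nat).
  { intros k. rewrite Ha1. unfold alpha_model.
    destruct (Nat.eqb_spec k 0) as [->|Hk].
    - simpl (0 - p)%nat. rewrite Kc_diag_0, Cmult_assoc. unfold CR. rewrite <- RtoC_mult.
      replace (1 / PI * PI) with 1 by (field; lra). ring.
    - destruct (Nat.leb_spec k p) as [Hkp|Hkp]; [unfold CR; ring|].
      rewrite Kc_diag, Cmult_assoc by lia. unfold CR. rewrite <- RtoC_mult.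
      replace (2 / PI * (PI / 2)) with 1 by (field; lra). ring. }
  (* The sum is written [0 - l] to match [b - a] at [b = 0]; the minus sign of the terms is that of
     the second column of [Qmat]. *)
  assert (Hser : forall (f : nat -> C) l, Cseries (fun i => f i * g i)%C l ->
     Cseries (fun k => - (f (k - p)%nat * (alpha_model p k * a1 k)))%C (0 - l)%C).
  { intros f l Hf. replace (0 - l)%C with (- (1) * l)%C by ring.
    apply (is_series_ext (V := C_NormedModule)
      (fun k => - (1) * (if (k =? 0)%nat then f 0%nat * g 0%nat
                    else if (k <=? p)%nat then 0 else f (k - p)%nat * g (k - p)%nat))%C).
    - intros k. rewrite Hw. destruct (Nat.eqb_spec k 0) as [->|Hk].
      + simpl (0 - p)%nat. in_C; ring.
      + destruct (k <=? p)%nat; in_C; ring.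
    - apply Cseries_scal, (Cseries_model_index p (fun i => f i * g i)%C), Hf. }
  assert (HQm : forall n i k, Qe p lam alpha PI n i k true
     = (alpha_model p k * Kc (rhoI p lam n i) (k - p))%C).
  { intros n i k. unfold Qe. change (rhoI p lam k true) with (rho_model p k).
    rewrite rho_model_nat, Dt_Kc. reflexivity. }
  (* [X] carries the weight [alpha_k]: either it vanishes or [G(rho_k)] does. *)
  assert (Hzero : forall k X, (alpha k = CR 0 -> X = RtoC 0) -> (X * (rho_hat p lam k * a0 k + a1 k) = 0)%C).
  { intros k X HX. destruct (classic (alpha k = CR 0)) as [E|E].
    - rewrite (HX E). ring.
    - rewrite (Hc0 k E). ring. }
  assert (HQz : forall n i k, alpha k = CR 0 -> Qe p lam alpha PI n i k false = RtoC 0).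
  { intros n i k E. unfold Qe. change (alphaI p alpha k false) with (alpha k). rewrite E. unfold CR; ring. }
  assert (Hsnd : forall n k, snd (M2app (Hmat p lam alpha PI n k) (a0 k, a1 k))
     = (- (Kc (rho_model p n) (k - p) * (alpha_model p k * a1 k)))%C).
  { intros n k.
    transitivity (Qe p lam alpha PI n true k false * (rho_hat p lam k * a0 k + a1 k)
                  - Qe p lam alpha PI n true k true * a1 k)%C.
    - unfold Hmat. destruct (excluded_middle_informative (rho_hat p lam n = CR 0)); simpl; unfold CR; ring.
    - rewrite Hzero by (apply HQz). rewrite HQm. simpl rhoI. ring. }
  assert (Hfst : forall n k, fst (M2app (Hmat p lam alpha PI n k) (a0 k, a1 k))
     = (- (dq n (k - p)%nat * (alpha_model p k * a1 k)))%C).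
  { intros n k. unfold Hmat. destruct (excluded_middle_informative (rho_hat p lam n = CR 0)) as [E|E].
    - transitivity (dQe p lam alpha PI n k false * (rho_hat p lam k * a0 k + a1 k)
                    - dQe p lam alpha PI n k true * a1 k)%C; [simpl; unfold CR; ring|].
      rewrite Hzero.
      + replace (dQe p lam alpha PI n k true) with (alpha_model p k * dq n (k - p)%nat)%C; [ring|].
        symmetry. apply Cderiv_unique.
        apply (is_derive_ext (fun r => alpha_model p k * Kc r (k - p))%C); [|apply (Hdq3 n _ E)].
        intros r. simpl. unfold lam_model. rewrite rho_model_nat, Dt_Kc. reflexivity.
      + intros Ek. apply Cderiv_unique.
        apply (is_derive_ext (K := C_AbsRing) (V := C_NormedModule) (fun _ => RtoC 0)).
        * intros r. simpl. rewrite Ek. unfold CR. in_C; ring.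
        * apply (is_derive_const (K := C_AbsRing) (V := C_NormedModule)).
    - transitivity (/ rho_hat p lam n * ((Qe p lam alpha PI n false k false * (rho_hat p lam k * a0 k + a1 k)
           - Qe p lam alpha PI n true k false * (rho_hat p lam k * a0 k + a1 k))
           - (Qe p lam alpha PI n false k true - Qe p lam alpha PI n true k true) * a1 k))%C;
        [simpl; unfold CR; ring|].
      (* What survives is the difference quotient of the kernel, which is [dq] by [Hdq2]. *)
      rewrite !Hzero by (apply HQz). rewrite !HQm. simpl rhoI. rewrite (Hdq2 n (k - p)%nat).
      field. exact E. }
  assert (Hbz : bounded_seq (fun _ => (RtoC 0, RtoC 0))).
  { exists 0. intros _; simpl. rewrite Cmod_0. lra. }
  (* Uniqueness fails at the zero sequence: the kernel vector and 0 are both preimages of it. *)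
  destruct (Hinv _ Hbz) as [a [_ [_ Huniq]]].
  assert (Ea : (fun n => (a0 n, a1 n)) = a).
  { apply Huniq.
    - exists (Q * G + PI * G). intros n; simpl.
      assert (B0 := Cseries_Cmod_le _ _ _ (H0 n) (Hb0 n)).
      assert (B1 := Cseries_Cmod_le _ _ _ (H1 n) (Hb1 n)).
      assert (P0 := Cmod_ge_0 (a0 n)). assert (P1 := Cmod_ge_0 (a1 n)). lra.
    - intros n. split.
      + apply (is_series_ext (V := C_NormedModule) (fun k => - (dq n (k - p)%nat * (alpha_model p k * a1 k)))%C);
          [intros k; rewrite Hfst; reflexivity|]. apply Hser, H0.
      + apply (is_series_ext (V := C_NormedModule) (fun k => - (Kc (rho_model p n) (k - p)%nat * (alpha_model p k * a1 k)))%C);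
          [intros k; rewrite Hsnd; reflexivity|]. apply (Hser (Kc (rho_model p n))), H1. }
  assert (Ez : (fun _ => (RtoC 0, RtoC 0)) = a).
  { apply Huniq; [exact Hbz|]. intros n. simpl fst; simpl snd.
    split; (replace (0 - 0)%C with (RtoC 0) by ring;
      refine (is_series_ext (V := C_NormedModule) (fun _ => RtoC 0) _ _ _
                (Cseries_single (fun _ => RtoC 0) 0 (fun _ _ => eq_refl)));
      intros k; in_C; ring). }
  (* Position [i0 + p] has model frequency [i0], so [a1] there is [K(i0, i0) g_i0]. *)
  assert (Hv : a1 (i0 + p)%nat = RtoC 0).
  { rewrite <- Ez in Ea. exact (f_equal (fun b => snd (b (i0 + p)%nat)) Ea). }
  rewrite Ha1 in Hv. replace (i0 + p - p)%nat with i0 in Hv by lia.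
  apply (f_equal Cmod) in Hv. rewrite Cmod_mult, Cmod_0 in Hv.
  apply Rmult_integral in Hv. destruct Hv as [Hv|Hv]; apply Cmod_eq_0 in Hv; [|contradiction].
  destruct i0 as [|i0]; [rewrite Kc_diag_0 in Hv | rewrite Kc_diag in Hv by lia];
    apply (f_equal fst) in Hv; simpl in Hv; lra.
Qed.
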